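(* Let $k=2m-1\ge 1$ and $r\ge 1$. (1) If $\mathfrak{g}_{k,r}=\mathfrak{p}^A\frac{k|4|\cdots|4}{k+2|4|\cdots|4|2}$, with $r$ parts equal to $4$ on top and $r-1$ parts equal to $4$ followed by a part $2$ on the bottom, then $\mathfrak{g}_{k,r}$ has the unimodal spectrum property and its spectrum is $\{-1^{2r},0^{6r-1},1^{6r-1},2^{2r}\}$ if $k=1$, $\{-2,-1^{2r+2},0^{6r+2},1^{6r+2},2^{2r+2},3\}$ if $k=3$, and $$\{-m,(-m+1)^3,-1^{2(k+r)-5},0^{2(k+3r)-4},1^{2(k+3r)-4},2^{2(k+r)-5},m^3,m+1\}\cup\bigcup_{i=2}^{m-2}\{(-m+i)^{4i-2},(m-i+1)^{4i-2}\}$$ if $k>3$. (2) If $\mathfrak{g}_{k,r}=\mathfrak{p}^A\frac{k|4|\cdots|4|2}{k+2|4|\cdots|4}$, with $r$ parts equal to $4$ followed by a part $2$ on top and $r$ parts equal to $4$ on the bottom, then $\mathfrak{g}_{k,r}$ has the unimodal spectrum property and its spectrum is $\{-1^{2r+1},0^{6r+2},1^{6r+2},2^{2r+1}\}$ if $k=1$, $\{-2,-1^{2r+3},0^{6r+5},1^{6r+5},2^{2r+3},3\}$ if $k=3$, and $$\{-m,(-m+1)^3,-1^{2(k+r)-4},0^{2(k+3r)-1},1^{2(k+3r)-1},2^{2(k+r)-4},m^3,m+1\}\cup\bigcup_{i=2}^{m-2}\{(-m+i)^{4i-2},(m-i+1)^{4i-2}\}$$ if $k>3$.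
   Context: Type-A seaweeds: for compositions $\underline a=(a_1,\dots,a_m)$ and $\underline b=(b_1,\dots,b_t)$ of $n$, let $e_1,\dots,e_n$ be a basis of $V=\mathbb{C}^n$, $V_i=\mathrm{span}\{e_1,\dots,e_{a_1+\dots+a_i}\}$ and $W_j=\mathrm{span}\{e_{b_1+\dots+b_j+1},\dots,e_n\}$. The type-A seaweed $\mathfrak{p}^A\frac{a_1|\cdots|a_m}{b_1|\cdots|b_t}$ is the subalgebra of $\mathfrak{sl}(n)$ of matrices preserving both flags $0\subset V_1\subset\dots\subset V_m=V$ and $V=W_0\supset W_1\supset\dots\supset W_t=0$. These algebras are Frobenius: there is $F\in\mathfrak{g}^*$ with $(x,y)\mapsto F([x,y])$ nondegenerate; the unique $\widehat F\in\mathfrak{g}$ with $F([\widehat F,x])=F(x)$ for all $x$ defines the spectrum of $\mathfrak{g}$ as the multiset of eigenvalues of $\mathrm{ad}\,\widehat F$ on $\mathfrak{g}$. A Frobenius type-A seaweed has the unimodal spectrum property if, listing its distinct eigenvalues in increasing order, the corresponding sequence of multiplicities $c_0,\dots,c_N$ is unimodal, i.e. $c_0\le\dots\le c_j\ge\dots\ge c_N$ for some $j$. Notation: $\{x^k\}$ denotes $x$ with multiplicity $k$, and $\cup$ denotes multiset union (multiplicities add). *)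

(* Defs.v *)
From HB Require Import structures.
From mathcomp Require Import all_boot all_order all_algebra.
From mathcomp Require Import complex reals.

Set Implicit Arguments.
Unset Strict Implicit.
Unset Printing Implicit Defensive.

Import Order.TTheory GRing.Theory Num.Theory.
Local Open Scope ring_scope.

Section Seaweed.
Variables (K : fieldType) (n : nat).

(* Matrices act on column vectors; [delta_mx l ord0] is the basis vector
   $e_{l+1}$, as ordinals start at 0. *)
Definition flagV (a : seq nat) (i : nat) : {vspace 'cV[K]_n} :=
  (\sum_(l < n | (l < sumn (take i a))%N) <[delta_mx l ord0]>)%VS.

Definition flagW (b : seq nat) (j : nat) : {vspace 'cV[K]_n} :=
  (\sum_(l < n | (sumn (take j b) <= l)%N) <[delta_mx l ord0]>)%VS.

Definition preserving (U : {vspace 'cV[K]_n}) : {vspace 'M[K]_n} :=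
  (\bigcap_(v <- vbasis U) (linfun (mulmxr v) @^-1: U))%VS.

Lemma mem_preserving (U : {vspace 'cV[K]_n}) (x : 'M[K]_n) :
  reflect (forall v, v \in U -> x *m v \in U) (x \in preserving U).
Proof.
have memE (s : seq 'cV[K]_n) :
    (x \in (\bigcap_(v <- s) (linfun (mulmxr v) @^-1: U))%VS)
      = all (fun v => x *m v \in U) s.
  elim: s => [|v s IHs]; first by rewrite big_nil memvf.
  by rewrite big_cons memv_cap IHs -memv_preim lfunE.
rewrite /preserving memE; apply: (iffP allP) => [xU v Uv | xU v /vbasis_mem].
  rewrite (coord_vbasis Uv) mulmx_sumr rpred_sum // => i _.
  by rewrite -scalemxAr rpredZ // xU // memt_nth.
exact: xU.
Qed.

Definition sl : {vspace 'M[K]_n} :=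
  lker (linfun (mxtrace : 'M[K]_n -> K^o)).

Lemma mem_sl (x : 'M[K]_n) : (x \in sl) = (\tr x == 0).
Proof. by rewrite memv_ker lfunE. Qed.

(* For [a] and [b] compositions of [n]. *)
Definition seaweed (a b : seq nat) : {vspace 'M[K]_n} :=
  (sl :&: (\bigcap_(i < (size a).+1) preserving (flagV a i))
      :&: (\bigcap_(j < (size b).+1) preserving (flagW b j)))%VS.

Definition mxbr (x y : 'M[K]_n) : 'M[K]_n := x *m y - y *m x.

Lemma memv_bigcap m (U : 'I_m -> {vspace 'M[K]_n}) x :
  reflect (forall i, x \in U i) (x \in (\bigcap_i U i)%VS).
Proof.
rewrite memvE; apply: (iffP subv_bigcapP) => xU i; first by rewrite memvE xU.
by rewrite -memvE.
Qed.

Lemma mem_seaweed a b x :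
  x \in seaweed a b <->
  [/\ \tr x = 0,
      forall i, (i <= size a)%N ->
        forall v, v \in flagV a i -> x *m v \in flagV a i
    & forall j, (j <= size b)%N ->
        forall v, v \in flagW b j -> x *m v \in flagW b j].
Proof.
rewrite /seaweed !memv_cap mem_sl; split.
  case/andP=> /andP[/eqP tr0 /memv_bigcap xV] /memv_bigcap xW.
  split=> // i; rewrite -ltnS => lti.
    by apply/mem_preserving; apply: (xV (Ordinal lti)).
  by apply/mem_preserving; apply: (xW (Ordinal lti)).
case=> -> xV xW; rewrite eqxx /=.
apply/andP; split; apply/memv_bigcap => i; apply/mem_preserving.
  by apply: xV; rewrite -ltnS.
by apply: xW; rewrite -ltnS.
Qed.

Lemma seaweed_mxbr a b x y :
  x \in seaweed a b -> y \in seaweed a b -> mxbr x y \in seaweed a b.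
Proof.
case/mem_seaweed=> _ xV xW /mem_seaweed[_ yV yW]; apply/mem_seaweed; split.
- by rewrite /mxbr linearB /= mxtrace_mulC subrr.
- move=> i hi v Vv; rewrite mulmxBl -!mulmxA.
  by apply: rpredB; [apply/xV/yV | apply/yV/xV].
- move=> i hi v Vv; rewrite mulmxBl -!mulmxA.
  by apply: rpredB; [apply/xW/yW | apply/yW/xW].
Qed.

End Seaweed.

Section Spectrum.
Variables (K : fieldType) (n : nat) (g : {vspace 'M[K]_n}).

(* The commutator as an operation on [g]; the projection [vsproj] is the
   identity when [g] is a Lie subalgebra, see [vsval_lbr]. *)
Definition lbr (x y : subvs_of g) : subvs_of g :=
  vsproj g (mxbr (vsval x) (vsval y)).

Lemma vsval_lbr :
    (forall x y, x \in g -> y \in g -> mxbr x y \in g) ->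
  forall x y, vsval (lbr x y) = mxbr (vsval x) (vsval y).
Proof. by move=> gbr x y; rewrite vsprojK // gbr // subvsP. Qed.

Lemma lbr_linearr x : linear (lbr x).
Proof.
move=> c y z; rewrite /lbr -linearP; congr (vsproj g _); rewrite /mxbr [vsval (_ + _)]linearP /=.
by rewrite mulmxDl mulmxDr -scalemxAl -scalemxAr opprD scalerBr addrACA.
Qed.

HB.instance Definition _ x :=
  GRing.isLinear.Build K (subvs_of g) (subvs_of g) _ (lbr x) (lbr_linearr x).

Definition ad (x : subvs_of g) : 'End(subvs_of g) := linfun (lbr x).

Lemma lbr_linearl y : linear (lbr^~ y).
Proof.
move=> c x z; rewrite /lbr -linearP; congr (vsproj g _); rewrite /mxbr [vsval (_ + _)]linearP /=.
by rewrite mulmxDl mulmxDr -scalemxAl -scalemxAr opprD scalerBr addrACA.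
Qed.

Lemma adE x y : ad x y = lbr x y.
Proof. by rewrite lfunE. Qed.

(* Left nondegeneracy suffices, the form being alternating. *)
Definition frobenius_functional (F : 'Hom(subvs_of g, K^o)) : Prop :=
  forall x, (forall y, F (lbr x y) = 0) -> x = 0.

Definition frobenius : Prop :=
  exists F : 'Hom(subvs_of g, K^o), frobenius_functional F.

Definition principal (F : 'Hom(subvs_of g, K^o)) (Fhat : subvs_of g) : Prop :=
  forall x, F (lbr Fhat x) = F x.

Lemma principal_exists F :
  frobenius_functional F -> exists! Fhat, principal F Fhat.
Proof.
move=> nondegF; pose B x : 'Hom(subvs_of g, K^o) := (F \o ad x)%VF.
have BE x y : B x y = F (lbr x y) by rewrite lfunE /= adE.
have linB : linear B.
  move=> c x z; apply/lfunP => y.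
  by rewrite add_lfunE scale_lfunE !BE lbr_linearl linearP.
pose Bl : {linear subvs_of g -> 'Hom(subvs_of g, K^o)} :=
  HB.pack B (GRing.isLinear.Build K _ _ _ B linB).
have kerB : lker (linfun Bl) == 0%VS.
  apply/lker0P => x z; rewrite !lfunE /= => eqB.
  apply/subr0_eq/nondegF => y.
  by rewrite -BE -[B _]/(Bl _) linearB /= eqB subrr lfunE.
have imB : limg (linfun Bl) = fullv.
  apply/eqP; rewrite eqEdim subvf limg_dim_eq; last first.
    by rewrite (eqP kerB) capv0.
  by rewrite !dimvf /dim /= muln1.
have /memv_imgP[Fhat _ FE] : F \in limg (linfun Bl) by rewrite imB memvf.
have principalP x : principal F x <-> B x = F.
  by split=> [Fx|Fx y]; [apply/lfunP => y; rewrite BE | rewrite -BE Fx].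
rewrite lfunE /= in FE.
exists Fhat; split=> [|x /principalP]; first exact/principalP.
by rewrite [in RHS]FE => eqB; apply: (lker0P kerB); rewrite !lfunE.
Qed.

(* Multisets are sequences up to permutation. The eigenvalues are counted with
   algebraic multiplicity; the choice of the basis is irrelevant. *)
Definition eigenvalues (f : 'End(subvs_of g)) (s : seq K) : Prop :=
  char_poly (passmx.mxof (vbasis fullv) (vbasis fullv) f) = \prod_(z <- s) ('X - z%:P).

(* The spectrum does not depend on the functional, so it is required to be [s]
   for every choice of it. *)
Definition has_spectrum (s : seq K) : Prop :=
  frobenius /\
  forall F Fhat, frobenius_functional F -> principal F Fhat ->
    eigenvalues (ad Fhat) s.

End Spectrum.

Definition unimodal (c : seq nat) : Prop :=
  exists2 j, (j < size c)%N & sorted leq (take j.+1 c) /\ sorted geq (drop j c).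

(* On complex numbers [x < y] means that x and y have the same imaginary part
   and that the real part of x is smaller. *)
Definition unimodal_spectrum (K : numFieldType) (n : nat)
    (g : {vspace 'M[K]_n}) : Prop :=
  exists2 s, has_spectrum g s &
  exists e : seq K, [/\ sorted <%R e, e =i s
    & unimodal [seq count_mem x s | x <- e]].

(* Main.v *)
Require Import Defs.
From HB Require Import structures.
From mathcomp Require Import all_boot all_order all_algebra.
From mathcomp Require Import perm zify ring.
From mathcomp Require Import complex reals.
Set Implicit Arguments.
Unset Strict Implicit.
Unset Printing Implicit Defensive.
Import Order.TTheory GRing.Theory Num.Theory.
Import passmx.
Local Open Scope ring_scope.

(** The spectrum does not depend on the functional: along a line of functionals
the principal element, with denominators cleared, satisfies a Lax equation, so
its characteristic polynomial has zero derivative. It is thus enough to treat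
the functional that sums the entries over the edges of the meander graph, for
which a diagonal matrix is principal and the eigenvalues are the differences of
its entries over the positions allowed in the seaweed.

For these compositions the graph is a single path, made of two parallel strands
joined by one last edge. In strand coordinates (rung, strand) the allowed
positions depend only on the two rungs, the kernel equations of the form
propagate along the strands, and both the weights and the multiplicities are
piecewise linear in the rungs. The two families differ only by the parity of
the number [u] of rungs after the large blocks ([u = 2r] and [u = 2r + 1]). *)

(** * Invariance of the spectrum *)

(** [has_spectrum] quantifies over all functionals. On the line between two of them the form may
    degenerate, so its determinant cannot be inverted there; the argument is an identity between
    polynomials in the line parameter, and it uses characteristic 0. The path starts at the centre
    of one of the two odd blocks, of sizes k and k + 2, follows one strand to the last rung and
    returns along the other to the centre of the second odd block. The kernel equations mostly carry
    entries from rung to rung; what kills them comes from the border of the support and from the two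
    ends. Neither end suffices alone: rung 0 leaves one pair of strand labels open, which the last
    rung settles, and only the joining edge compares the diagonal entries of the two strands. *)

Section DerivDet.
Variable A : comNzRingType.
Implicit Types p q : {poly A}.

Lemma deriv_prod n (f : 'I_n -> {poly A}) :
  (\prod_i f i)^`() = \sum_i \prod_j (if j == i then (f j)^`() else f j).
Proof.
elim: n f => [|n IHn] f; first by rewrite !big_ord0 derivC.
rewrite [RHS]big_ord_recl !(big_ord_recl n) derivM IHn /= mulr_sumr.
by congr (_ + _); apply: eq_bigr => i _; rewrite big_ord_recl.
Qed.

(** Jacobi's formula: differentiate one row at a time and expand along that row, whose cofactors do
    not see the change. *)
Lemma deriv_det n (M : 'M[{poly A}]_n) :
  (\det M)^`() = \tr (map_mx (@deriv A) M *m \adj M).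
Proof.
pose N i := \matrix_(j, l) (if j == i then (M j l)^`() else M j l).
transitivity (\sum_i \det (N i)).
  rewrite /determinant raddf_sum exchange_big; apply: eq_bigr => s _ /=.
  rewrite -mulr_sumr; case: (odd_perm s) => /=.
    rewrite !expr1 !mulN1r derivN deriv_prod; congr (- _).
    by apply: eq_bigr => i _; apply: eq_bigr => j _; rewrite mxE.
  rewrite !expr0 !mul1r deriv_prod.
  by apply: eq_bigr => i _; apply: eq_bigr => j _; rewrite mxE.
apply: eq_bigr => i _; rewrite (expand_det_row _ i) mxE.
apply: eq_bigr => j _; rewrite !mxE eqxx; congr (_ * _).
rewrite /cofactor; congr (_ * \det _).
by apply/matrixP => a b; rewrite !mxE eq_sym (negPf (neq_lift _ _)).
Qed.

End DerivDet.

(** The hypothesis says that the derivative of p / D^d is zero. Comparing coefficients avoids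
    fractions. *)
Lemma proportional_of_log_deriv (K : numFieldType) (D p : {poly K}) d :
    D.[0] != 0 -> D * p^`() = D^`() * p *+ d ->
  D.[0] ^+ d *: p = p.[0] *: D ^+ d.
Proof.
move=> D0 Dp; apply/subr0_eq; set Q := _ - _.
have Q0 : Q`_0 = 0.
  by rewrite -horner_coef0 !hornerE mulrC subrr.
have DE : D * (D ^+ d)^`() = D^`() * D ^+ d *+ d.
  rewrite deriv_exp mulrnAr; case: (d) => [|e]; first by rewrite !mulr0n.
  by rewrite exprS /= mulrCA.
have DQ : D * Q^`() = D^`() * Q *+ d.
  rewrite derivB !derivZ !mulrBr -!scalerAr Dp DE mulrnBl.
  by rewrite !scalerMnr.
(* In degree j of [DQ] all that survives is the constant term of D times j + 1 times the next
   coefficient of Q. *)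
apply/polyP; elim/ltn_ind => -[|j] IHj; first by rewrite Q0 coef0.
move/polyP/(_ j): DQ; rewrite coefMn !coefM big_ord_recl subn0.
rewrite big1 ?addr0 => [|i _]; last first.
  by rewrite coef_deriv IHj ?coef0 ?mul0rn ?mulr0 // ltnS ltn_subrL (leq_trans _ (ltn_ord i)).
rewrite big1 ?mul0rn => [|i _]; last first.
  by rewrite IHj ?coef0 ?mulr0 // ltnS leq_subr.
move/eqP; rewrite coef_deriv -horner_coef0 mulrnAr mulrn_eq0 mulf_eq0 (negPf D0) /=.
by move/eqP->; rewrite coef0.
Qed.

Section StructureConstants.
Variables (A : comNzRingType) (d : nat) (C : 'I_d -> 'M[A]_d).

(* The rows of [C i] are the coordinates of the brackets of the i-th basis
   vector, so that [h] has adjoint matrix [admx h], acting on row vectors. *)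
Definition admx (h : 'rV[A]_d) : 'M[A]_d := \sum_i h 0 i *: C i.

Lemma admx_linear : linear admx.
Proof.
move=> a x y; rewrite /admx scaler_sumr -big_split /=; apply: eq_bigr => i _.
by rewrite !mxE scalerDl scalerA.
Qed.

HB.instance Definition _ := GRing.isLinear.Build A _ _ _ admx admx_linear.

(** The Gram matrix of f([x, y]); by [mul_formmx], [admx h *m f = f] is the equation of the
    principal element. *)
Definition formmx (f : 'cV[A]_d) : 'M[A]_d := \matrix_(i, j) (C i *m f) j 0.

Lemma mul_formmx h f : h *m formmx f = (admx h *m f)^T.
Proof.
apply/rowP => j; rewrite !mxE (bigID predT) /= addrC big_pred0_eq add0r.
under eq_bigr do rewrite !mxE mulr_sumr.
rewrite exchange_big; apply: eq_bigr => l _ /=; rewrite summxE mulr_suml.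
by apply: eq_bigr => i _; rewrite !mxE mulrA.
Qed.

(** Matrices act on row vectors, so products compose in reverse: [C j *m C i] is the composite of
    the adjoints of the i-th and j-th basis vectors, the j-th acting first. *)
Definition jacobi : Prop :=
  forall i j, admx (row j (C i)) = C j *m C i - C i *m C j.

(** Here [y *m admx x] is the bracket [x, y]; bilinearity reduces the claim to basis vectors, where
    it is [jacobi]. *)
Lemma admx_bracket x y :
  jacobi -> admx (y *m admx x) = admx y *m admx x - admx x *m admx y.
Proof.
move=> jac; have bilin (T : 'M_d -> 'M_d -> 'M_d) :
    (forall M, linear (T M)) -> (forall M, linear (T^~ M)) ->
  T (admx y) (admx x) = \sum_i \sum_j (y 0 j * x 0 i) *: T (C j) (C i).
  move=> Tr Tl; pose Tl' M : {linear _ -> _} :=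
    HB.pack (T^~ M) (GRing.isLinear.Build A _ _ _ (T^~ M) (Tl M)).
  pose Tr' M : {linear _ -> _} :=
    HB.pack (T M) (GRing.isLinear.Build A _ _ _ (T M) (Tr M)).
  rewrite -[T _ _]/(Tr' _ _) linear_sum; apply: eq_bigr => i _.
  rewrite linearZ /= -[T _ _]/(Tl' _ _) linear_sum scaler_sumr.
  by apply: eq_bigr => j _; rewrite linearZ /= scalerA mulrC.
rewrite (bilin (fun M N => M *m N - N *m M)); last 2 first.
- move=> M c N1 N2; rewrite mulmxDl mulmxDr -scalemxAl -scalemxAr.
  by rewrite opprD scalerBr addrACA.
- move=> M c N1 N2; rewrite mulmxDl mulmxDr -scalemxAl -scalemxAr.
  by rewrite opprD scalerBr addrACA.
rewrite {2}/admx mulmx_sumr linear_sum; apply: eq_bigr => i _ /=.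
rewrite -scalemxAr linearZ /= mulmx_sum_row (linear_sum admx) scaler_sumr.
by apply: eq_bigr => j _; rewrite linearZ /= scalerA mulrC jac.
Qed.

End StructureConstants.

Lemma map_admx (A B : comNzRingType) (phi : {rmorphism A -> B}) d
    (C : 'I_d -> 'M[A]_d) h :
  map_mx phi (admx C h) = admx (fun i => map_mx phi (C i)) (map_mx phi h).
Proof.
rewrite /admx raddf_sum; apply: eq_bigr => i _ /=.
by apply/matrixP => a b; rewrite !mxE rmorphM.
Qed.

Lemma map_formmx (A B : comNzRingType) (phi : {rmorphism A -> B}) d
    (C : 'I_d -> 'M[A]_d) f :
  map_mx phi (formmx C f) = formmx (fun i => map_mx phi (C i)) (map_mx phi f).
Proof.
apply/matrixP => i j; rewrite !mxE rmorph_sum; apply: eq_bigr => l _.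
by rewrite rmorphM !mxE.
Qed.


Section SpectrumInvariance.
Variables (K : numFieldType) (d : nat) (C : 'I_d -> 'M[K]_d).
Hypothesis jacC : jacobi C.

Lemma map_jacobi (B : comNzRingType) (phi : {rmorphism K -> B}) :
  jacobi (fun i => map_mx phi (C i)).
Proof.
move=> i j; rewrite -map_row -map_admx jacC.
by rewrite map_mxB !map_mxM.
Qed.

Lemma admx_inj (B : idomainType) (C' : 'I_d -> 'M[B]_d) f g h :
  \det (formmx C' f) != 0 -> admx C' g *m f = admx C' h *m f -> g = h.
Proof.
move=> Bn0 /(congr1 trmx); rewrite -!mul_formmx => /(congr1 (mulmxr (\adj (formmx C' f)))).
rewrite /= -!mulmxA mul_mx_adj !mul_mx_scalar => gh.
by apply/rowP => i; move/rowP/(_ i): gh; rewrite !mxE => /(mulfI Bn0).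
Qed.

(* [h t / D t] is the principal element of the functional [f t] on the line
   from [f0] to [f1], up to clearing the determinant [D]. It moves along a Lax
   flow, so [\det (y - ad (h t / D t))] does not depend on [t]. *)
Lemma char_poly_principal (f0 f1 : 'cV[K]_d) (h0 h1 : 'rV[K]_d) :
    \det (formmx C f0) != 0 -> \det (formmx C f1) != 0 ->
    admx C h0 *m f0 = f0 -> admx C h1 *m f1 = f1 ->
  char_poly (admx C h0) = char_poly (admx C h1).
Proof.
move=> det0 det1 hf0 hf1.
pose CX i : 'M[{poly K}]_d := map_mx polyC (C i).
pose dX (a b : nat) (M : 'M[{poly K}]_(a, b)) := map_mx (@deriv K) M.
have dXM a b c (M : 'M_(a, b)) (N : 'M_(b, c)) :
    dX _ _ (M *m N) = dX _ _ M *m N + M *m dX _ _ N.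
  apply/matrixP => i j; rewrite !mxE raddf_sum -big_split; apply: eq_bigr => l _.
  by rewrite !mxE /= derivM.
have dad h : dX _ _ (admx CX h) = admx CX (dX _ _ h).
  apply/matrixP => i j; rewrite !mxE !summxE raddf_sum; apply: eq_bigr => l _.
  by rewrite !mxE /= derivM derivC mulr0 addr0.
have dXZ a b c (M : 'M_(a, b)) : dX _ _ (c *: M) = c^`() *: M + c *: dX _ _ M.
  by apply/matrixP => i j; rewrite !mxE derivM.
pose f : 'cV[{poly K}]_d := map_mx polyC f0 + 'X *: map_mx polyC (f1 - f0).
pose D := \det (formmx CX f).
(* Cramer's rule: the adjugate gives polynomial solutions up to the factor D. *)
pose sol (g : 'cV[{poly K}]_d) := g^T *m \adj (formmx CX f).
have solE g : admx CX (sol g) *m f = D *: g.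
  by apply: trmx_inj; rewrite -mul_formmx -mulmxA mul_adj_mx mul_mx_scalar linearZ.
pose ev t (a b : nat) (M : 'M[{poly K}]_(a, b)) := map_mx (horner_eval t) M.
have ev_C t i : ev t _ _ (CX i) = C i.
  by apply/matrixP => a b; rewrite !mxE /= /horner_eval hornerC.
have evf t : ev t _ _ f = f0 + t *: (f1 - f0).
  by apply/matrixP => a b; rewrite !mxE /horner_eval !hornerE.
have ev_ad t h : ev t _ _ (admx CX h) = admx C (ev t _ _ h).
  rewrite /ev map_admx; apply: eq_bigr => i _; congr (_ *: _); exact: ev_C.
have evD t : D.[t] = \det (formmx C (f0 + t *: (f1 - f0))).
  rewrite -[LHS]/(horner_eval t D) -det_map_mx map_formmx -evf; congr (\det _).
  apply/matrixP => i j; rewrite !mxE; apply: eq_bigr => l _; congr (_ * _).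
  by rewrite !mxE /= /horner_eval hornerC.
have f_0 : f0 + 0 *: (f1 - f0) = f0 by rewrite scale0r addr0.
have f_1 : f0 + 1 *: (f1 - f0) = f1 by rewrite scale1r addrC subrK.
have D0 : D.[0] != 0 by rewrite evD f_0.
have D1 : D.[1] != 0 by rewrite evD f_1.
have Dn0 : D != 0 by apply: contraNneq D0 => ->; rewrite horner0.
have jacX : jacobi CX := map_jacobi polyC.
pose h := sol f; pose w := sol (dX _ _ f).
have hf : admx CX h *m f = D *: f := solE f.
(* The last term is the bracket [h, w]. By nondegeneracy it is enough to test both sides on f, where
   they are compared by differentiating [hf]. *)
have lax : D *: dX _ _ h = D^`() *: h + w *m admx CX h.
  apply: (@admx_inj _ CX f) => //.
  have wf : admx CX w *m f = D *: dX _ _ f := solE _.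
  have := congr1 (dX _ _) hf; rewrite dXM dad dXZ => /(canRL (addrK _)) dhf.
  rewrite (linearD (admx CX)) !(linearZ_LR (admx CX)) /= admx_bracket // -scalemxAl dhf.
  rewrite mulmxDl mulmxBl -scalemxAl -!mulmxA hf wf -!scalemxAr wf.
  by rewrite scalerBr scalerDr -addrA scalerA mulrC -scalerA.
pose N := admx CX h; pose W := admx CX w.
have laxN : D *: dX _ _ N = D^`() *: N + (W *m N - N *m W).
  by rewrite dad -(linearZ_LR (admx CX)) lax (linearD (admx CX)) (linearZ_LR (admx CX)) /= admx_bracket.
have ev_h t g : \det (formmx C (f0 + t *: (f1 - f0))) != 0 ->
    admx C g *m (f0 + t *: (f1 - f0)) = f0 + t *: (f1 - f0) ->
  ev t _ _ h = D.[t] *: g.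
  move=> dett gf; apply: (admx_inj dett); rewrite -ev_ad linearZ /= -scalemxAl gf.
  by rewrite -evf -map_mxM hf map_mxZ.
have ev0 : ev 0 _ _ h = D.[0] *: h0 by apply: ev_h; rewrite ?f_0.
have ev1 : ev 1 _ _ h = D.[1] *: h1 by apply: ev_h; rewrite ?f_1.
have char_polyE g y : (char_poly (admx C g)).[y] = \det (y%:M - admx C g).
  rewrite -[LHS]/(horner_eval y _) -det_map_mx; congr (\det _).
  by apply/matrixP => a b; rewrite !mxE /= /horner_eval hornerD hornerN hornerMn hornerX hornerC.
have detE t g y : ev t _ _ h = D.[t] *: g ->
    (\det ((y%:P * D)%:M - N)).[t] = D.[t] ^+ d * (char_poly (admx C g)).[y].
  move=> evh; rewrite -[LHS]/(horner_eval t _) -det_map_mx char_polyE -detZ.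
  congr (\det _); rewrite map_mxB map_scalar_mx -/(ev t _ _ N) ev_ad evh.
  rewrite scalerBr scale_scalar_mx (linearZ_LR (admx C)) /= /horner_eval.
  by rewrite !hornerE mulrC.
(* The spectral variable is fixed to a scalar, so that t is the only polynomial variable. *)
have eqy y : (char_poly (admx C h0)).[y] = (char_poly (admx C h1)).[y].
  set M := (y%:P * D)%:M - N.
  have DM : D *: dX _ _ M = D^`() *: M + (W *m M - M *m W).
    have -> : dX _ _ M = (y%:P * D^`())%:M - dX _ _ N.
      apply/matrixP => a b; rewrite !mxE derivB derivMn derivM derivC mul0r add0r.
      by [].
    have -> : W *m M - M *m W = - (W *m N - N *m W).
      rewrite mulmxBl mulmxBr mul_scalar_mx mul_mx_scalar.
      by rewrite opprD addrACA subrr add0r -opprD.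
    rewrite !scalerBr laxN !scale_scalar_mx.
    have -> : D * (y%:P * D^`()) = D^`() * (y%:P * D) by ring.
    by rewrite opprD addrA.
  (* M commutes with its adjugate, so the Lax term drops out of the derivative of [\det M] and only
     the rescaling by D is left. *)
  have tr0 : \tr ((W *m M - M *m W) *m \adj M) = 0.
    apply/eqP; rewrite mulmxBl raddfB subr_eq0 /= -!(mulmxA _ _ (\adj M)).
    by rewrite mul_mx_adj (mxtrace_mulC M) -mulmxA mul_adj_mx.
  have logd : D * (\det M)^`() = D^`() * \det M *+ d.
    rewrite deriv_det -/(dX _ _ M) -mxtraceZ scalemxAl DM mulmxDl mxtraceD tr0.
    by rewrite addr0 -scalemxAl mul_mx_adj mxtraceZ mxtrace_scalar mulrnAr.
  have := proportional_of_log_deriv D0 logd.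
  move/(congr1 (horner^~ 1)); rewrite !hornerZ horner_exp.
  rewrite (detE 0 h0) // (detE 1 h1) // -mulrA => /(mulfI (expf_neq0 d D0)).
  by rewrite mulrC => /(mulIf (expf_neq0 d D1)).
(* The integers 0, 1, 2, ... are distinct in K and would give p as many roots as its size, one more
   than its degree. *)
apply/subr0_eq/eqP; set p := _ - _; apply/contraT => pn0.
have := @max_poly_roots _ p [seq i%:R | i <- iota 0 (size p)] pn0.
rewrite size_map size_iota ltnn map_inj_uniq ?iota_uniq; last first.
  by move=> i j /eqP; rewrite eqr_nat => /eqP.
move=> -> //; apply/allP => _ /mapP[i _ ->].
by rewrite rootE hornerD hornerN eqy subrr.
Qed.

End SpectrumInvariance.

(** * Transfer from structure constants to Lie algebras of matrices *)

Section LieSpectrum.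
Variables (K : numFieldType) (n : nat) (g : {vspace 'M[K]_n}).
Hypothesis g_mxbr : forall x y, x \in g -> y \in g -> mxbr x y \in g.
Local Notation L := (subvs_of g).
Local Notation e := (vbasis {:L}).
Local Notation mxe := (mxof e e).
Local Notation coords := (rVof e).

Lemma ad_lbr (x y : L) : ad (lbr x y) = ((ad x \o ad y) - (ad y \o ad x))%VF.
Proof.
apply/lfunP => z; rewrite add_lfunE opp_lfunE !comp_lfunE !adE.
apply: val_inj; change (vsval (lbr (lbr x y) z) = vsval (lbr x (lbr y z) - lbr y (lbr x z))).
rewrite linearB /= !vsval_lbr // /mxbr.
rewrite !mulmxBl !mulmxBr !mulmxA.
do 6!move: (_ *m _ *m _) => ?.
by apply/matrixP => i j; rewrite !mxE; ring.
Qed.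

Let basis_e : basis_of {:L} e := vbasisP _.

Definition lie_structure (i : 'I_(\dim {:L})) : 'M[K]_(\dim {:L}) :=
  mxe (ad e`_i).

Lemma admx_coords (x : L) : admx lie_structure (coords x) = mxe (ad x).
Proof.
have ad_lin : linear (@ad K n g).
  move=> c u v; apply/lfunP => y.
  by rewrite add_lfunE scale_lfunE !adE lbr_linearl.
pose adl : {linear L -> 'End(L)} :=
  HB.pack (@ad K n g) (GRing.isLinear.Build K _ _ _ _ ad_lin).
rewrite -{2}[x](rVofK basis_e) -[ad _]/(adl _) !linear_sum.
by apply: eq_bigr => i _; rewrite !linearZ.
Qed.

Lemma lie_structure_jacobi : jacobi lie_structure.
Proof.
move=> i j; have -> : row j (lie_structure i) = coords (lbr e`_i e`_j).
  by rewrite rowE mul_mxof vecof_delta adE.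
by rewrite admx_coords ad_lbr linearB /= !(mxof_comp _ _ basis_e).
Qed.

Definition functional_coords (F : 'Hom(L, K^o)) : 'cV[K]_(\dim {:L}) :=
  \col_i F e`_i.

Lemma functional_coordsE F x : (coords x *m functional_coords F) 0 0 = F x.
Proof.
rewrite -{2}[x](rVofK basis_e) linear_sum mxE.
by apply: eq_bigr => i _; rewrite [in RHS]linearZ /= [functional_coords _ _ _]mxE.
Qed.

Lemma form_coords F x y :
  (coords x *m formmx lie_structure (functional_coords F) *m (coords y)^T) 0 0
    = F (lbr x y).
Proof.
rewrite mul_formmx -trmx_mul mulmxA mxE admx_coords.
by rewrite -rVof_app // functional_coordsE adE.
Qed.

Lemma frobenius_functional_det F :
  frobenius_functional F ->
  \det (formmx lie_structure (functional_coords F)) != 0.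
Proof.
move=> frobF; apply/det0P => -[v vn0 vB].
move/eqP: vn0; apply; apply/eqP; rewrite -(vecof_eq0 basis_e); apply/eqP/frobF => y.
by rewrite -form_coords vecofK // vB mul0mx mxE.
Qed.

Lemma principal_coords F x :
  principal F x ->
  admx lie_structure (coords x) *m functional_coords F = functional_coords F.
Proof.
move=> pF; apply/colP => j; rewrite admx_coords.
have -> : functional_coords F j 0 = F (lbr x e`_j) by rewrite mxE pF.
rewrite -functional_coordsE -adE (rVof_app _ basis_e) // rVofE // -mulmxA.
by rewrite -rowE !mxE.
Qed.

Lemma has_spectrum_of_principal F x s :
    frobenius_functional F -> principal F x -> @eigenvalues K n g (ad x) s ->
  has_spectrum g s.
Proof.
move=> frobF pF specx; split; first by exists F.
move=> F' x' frobF' pF'; rewrite /eigenvalues -specx -!admx_coords.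
exact: (char_poly_principal lie_structure_jacobi
  (frobenius_functional_det frobF') (frobenius_functional_det frobF)
  (principal_coords pF') (principal_coords pF)).
Qed.

End LieSpectrum.

Lemma char_poly_eigenbasis (K : fieldType) (V : vectType K)
    (e : (\dim {:V}).-tuple V) (f : 'End(V)) m (X : m.-tuple V) (z : 'I_m -> K) :
    basis_of {:V} e -> basis_of {:V} X ->
    (forall i : 'I_m, f X`_i = z i *: X`_i) ->
  char_poly (mxof e e f) = \prod_i ('X - (z i)%:P).
Proof.
move=> be bX; have Em : m = \dim {:V} by rewrite -(size_basis bX).
subst m => fX; set A := mxof _ _ _.
pose P : 'M_(\dim {:V}) := \matrix_i rVof e X`_i; pose D := diag_mx (\row_i z i).
have PA : P *m A = D *m P.
  apply/row_matrixP => i; rewrite !row_mul rowK mul_mxof rVofK //.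
  by rewrite fX linearZ row_diag_mx -scalemxAl -rowE rowK mxE.
have Pu : \det P != 0.
  apply/det0P => -[v vn0 vP]; case/negP: vn0; rewrite -(vecof_eq0 bX).
  rewrite -(rVof_eq0 be) /vecof linear_sum.
  apply/eqP; transitivity (v *m P) => //; rewrite mulmx_sum_row.
  by apply: eq_bigr => i _; rewrite linearZ rowK.
have -> : char_poly A = char_poly D.
  (* Comparing P (X - A) with (X - D) P lets [\det P] cancel, so P is never inverted. *)
  pose PX := map_mx polyC P.
  have PXn0 : \det PX != 0 by rewrite det_map_mx polyC_eq0.
  apply: (mulfI PXn0); rewrite -det_mulmx mulrC -det_mulmx; congr (\det _).
  rewrite /char_poly_mx mulmxBr mulmxBl mul_mx_scalar mul_scalar_mx.
  by rewrite -!map_mxM PA.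
rewrite char_poly_trig ?diag_mx_is_trig //; apply: eq_bigr => i _.
by rewrite !mxE eqxx mulr1n.
Qed.

(** * Seaweeds given by a pattern of entries *)

Lemma mxtrace_delta (A : nzRingType) n (i j : 'I_n) :
  \tr (delta_mx i j : 'M[A]_n) = (i == j)%:R.
Proof.
rewrite /mxtrace (bigD1 i) //= big1 ?addr0 => [|l /negPf li]; rewrite !mxE ?eqxx //.
by rewrite li.
Qed.

Section PatternSpectrum.
Variables (K : numFieldType) (n : nat) (g : {vspace 'M[K]_n}).
Variables (S phi : rel 'I_n) (d : 'I_n -> int) (i0 : 'I_n).
Hypothesis g_mxbr : forall x y, x \in g -> y \in g -> mxbr x y \in g.
Hypothesis S_refl : reflexive S.
Hypothesis gP : forall x : 'M[K]_n,
  x \in g <-> \tr x = 0 /\ forall i j, ~~ S i j -> x i j = 0.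
Hypothesis d_phi : forall i j, phi i j -> d i - d j = 1.
(** The equation at (p, q) says that the edge sum of the bracket of x with the matrix unit at (p, q)
    vanishes. The trace of x is left free, so the expected kernel is the scalars. *)
Hypothesis phi_kernel : forall x : 'M[K]_n,
    (forall i j, ~~ S i j -> x i j = 0) ->
    (forall p q, S p q -> \sum_(i | phi i q) x i p = \sum_(j | phi p j) x q j) ->
  exists c, x = c%:M.

Let nK : n%:R != 0 :> K.
Proof. by rewrite pnatr_eq0 -lt0n (leq_trans _ (ltn_ord i0)). Qed.

Definition edge_sum (x : subvs_of g) : K^o :=
  \sum_(e | phi e.1 e.2) vsval x e.1 e.2.

Lemma edge_sum_linear : linear edge_sum.
Proof.
move=> c x y; rewrite /edge_sum scaler_sumr -big_split; apply: eq_bigr => e _.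
by rewrite linearP !mxE.
Qed.

HB.instance Definition _ :=
  GRing.isLinear.Build K (subvs_of g) K^o _ edge_sum edge_sum_linear.

Lemma edge_sum_lbr x y :
  linfun edge_sum (lbr x y)
    = \sum_(e | phi e.1 e.2) mxbr (vsval x) (vsval y) e.1 e.2.
Proof. by rewrite lfunE /= /edge_sum vsval_lbr. Qed.

Lemma mem_diag (u : 'I_n -> K) :
  \sum_i u i = 0 -> diag_mx (\row_i u i) \in g.
Proof.
move=> u0; apply/gP; split=> [|i j nSij].
  by rewrite mxtrace_diag -[RHS]u0; apply: eq_bigr => i _; rewrite mxE.
by rewrite !mxE; case: eqP nSij => [->|//]; rewrite S_refl.
Qed.

Lemma frobenius_edge_sum : frobenius_functional (linfun edge_sum).
Proof.
move=> x Fx; have [trx xS] := (gP (vsval x)).1 (subvsP x).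
have [p q Spq|c xc] := phi_kernel xS.
  (* A scalar correction makes the matrix unit traceless and does not change its brackets. *)
  pose y : 'M[K]_n := delta_mx p q - (\tr (delta_mx p q : 'M[K]_n) / n%:R)%:M.
  have gy : y \in g.
    apply/gP; split=> [|i j nSij].
      by rewrite linearB /= mxtrace_scalar -[_ *+ n]mulr_natr divfK ?subrr.
    rewrite !mxE; have /negPf -> : ~~ ((i == p) && (j == q)).
      by apply: contra nSij => /andP[/eqP-> /eqP->].
    by case: eqP nSij => [->|//]; rewrite ?S_refl // subr0.
  have := Fx (vsproj g y); rewrite edge_sum_lbr vsprojK //.
  have -> : mxbr (vsval x) y = mxbr (vsval x) (delta_mx p q).
    rewrite /mxbr mulmxBr mulmxBl mul_mx_scalar mul_scalar_mx.
    by rewrite opprB addrA subrK.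
  move=> Fpq; apply/subr0_eq; rewrite -[RHS]Fpq.
  have sumE1 : \sum_(e | phi e.1 e.2) (vsval x *m delta_mx p q) e.1 e.2
      = \sum_(i | phi i q) vsval x i p.
    rewrite -(pair_big_dep predT (fun i j => phi i j)
      (fun i j => (vsval x *m delta_mx p q) i j)) /=.
    rewrite [RHS]big_mkcond; apply: eq_bigr => i _.
    rewrite big_mkcond (bigD1 q) //= big1 ?addr0 => [|j /negPf jq]; last first.
      rewrite mxE big1 ?if_same // => l _; by rewrite !mxE jq andbF mulr0.
    case: ifP => // _; rewrite mxE (bigD1 p) //= !mxE !eqxx mulr1 big1 ?addr0 //.
    by move=> l /negPf lp; rewrite !mxE lp mulr0.
  have sumE2 : \sum_(e | phi e.1 e.2) (delta_mx p q *m vsval x) e.1 e.2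
      = \sum_(j | phi p j) vsval x q j.
    rewrite -(pair_big_dep predT (fun i j => phi i j)
      (fun i j => (delta_mx p q *m vsval x) i j)) /=.
    rewrite (bigD1 p) //= [X in _ + X]big1 ?addr0 => [|i /negPf ip]; last first.
      by apply: big1 => j _; rewrite mxE big1 // => l _; rewrite !mxE ip mul0r.
    apply: eq_bigr => j _; rewrite mxE (bigD1 q) //= !mxE !eqxx mul1r big1 ?addr0 //.
    by move=> l /negPf lp; rewrite !mxE lp andbF mul0r.
  rewrite -sumE1 -sumE2 -sumrB; apply: eq_bigr => e _.
  by rewrite /mxbr !mxE.
apply: val_inj; change (vsval x = vsval (0 : subvs_of g)); rewrite linear0 xc.
move: trx; rewrite xc mxtrace_scalar => /eqP.
rewrite -mulr_natr mulf_eq0 (negPf nK) orbF => /eqP ->.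
by apply/matrixP => i j; rewrite !mxE mul0rn.
Qed.

(** Subtracting the mean gives trace zero and keeps the differences of weights, hence the
    bracket. *)
Definition grading : 'M[K]_n :=
  diag_mx (\row_i ((d i)%:~R - (\sum_j (d j)%:~R) / n%:R)).

Lemma grading_mem : grading \in g.
Proof.
apply: mem_diag; rewrite sumrB sumr_const card_ord -[_ *+ n]mulr_natr divfK //.
exact: subrr.
Qed.

Lemma mxbr_grading (x : 'M[K]_n) i j :
  mxbr grading x i j = (d i - d j)%:~R * x i j.
Proof.
rewrite /mxbr mul_diag_mx mul_mx_diag !mxE rmorphB /=.
by rewrite [x i j * _]mulrC -mulrBl; congr (_ * _); ring.
Qed.

Lemma principal_grading : principal (linfun edge_sum) (vsproj g grading).
Proof.
move=> x; rewrite edge_sum_lbr vsprojK ?grading_mem // lfunE.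
by apply: eq_bigr => e /d_phi de; rewrite mxbr_grading de mul1r.
Qed.

(** The trace condition determines the entry at (i0, i0) from the other diagonal entries, so one
    diagonal position is lost. *)
Definition pattern_pairs : {set 'I_n * 'I_n} :=
  [set p | S p.1 p.2 && (p != (i0, i0))].

Definition pattern_vec (p : 'I_n * 'I_n) : 'M[K]_n :=
  delta_mx p.1 p.2 - (p.1 == p.2)%:R *: delta_mx i0 i0.

Lemma pattern_vecE p q : q != (i0, i0) -> pattern_vec p q.1 q.2 = (q == p)%:R.
Proof.
case: p q => p1 p2 [q1 q2]; rewrite !xpair_eqE !mxE /= => /negPf->.
by rewrite mulr0 subr0.
Qed.

Lemma pattern_vec_mem p : p \in pattern_pairs -> pattern_vec p \in g.
Proof.
case: p => p q; rewrite inE /= => /andP[Spq pq].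
apply/gP; split=> [|i j nSij].
  rewrite linearB linearZ /= !mxtrace_delta eqxx mulr1.
  by rewrite subrr.
have ij : (i, j) != (i0, i0) by apply: contra nSij => /eqP[-> ->].
rewrite (pattern_vecE (p, q) ij); case: eqP nSij => // -[-> ->].
by rewrite Spq.
Qed.

Lemma pattern_decomp x : x \in g ->
  x = \sum_(p in pattern_pairs) x p.1 p.2 *: pattern_vec p.
Proof.
move=> gx; apply/subr0_eq; set y := _ - _.
have yE q : q != (i0, i0) -> y q.1 q.2 = 0.
  move=> qn0; rewrite !mxE summxE.
  have [Sq|nSq] := boolP (S q.1 q.2).
    rewrite (bigD1 q) ?inE ?Sq //= mxE pattern_vecE // eqxx mulr1 big1 ?addr0 ?subrr //.
    by move=> p /andP[_ /negPf pq]; rewrite mxE pattern_vecE // eq_sym pq mulr0.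
  rewrite ((gP x).1 gx).2 // big1 ?subrr // => p; rewrite inE => /andP[Sp _].
  rewrite mxE pattern_vecE //; case: eqP => [qp|_]; last by rewrite mulr0.
  by move: nSq; rewrite qp Sp.
have gy : y \in g.
  by rewrite rpredB // rpred_sum // => p Jp; rewrite rpredZ // pattern_vec_mem.
apply/matrixP => i j; rewrite [RHS]mxE.
have [[-> ->]|/yE//] := eqVneq (i, j) (i0, i0).
rewrite -[RHS]((gP y).1 gy).1 /mxtrace (bigD1 i0) //= big1 ?addr0 // => l li0.
by rewrite (yE (l, l)) // xpair_eqE (negPf li0).
Qed.

Lemma has_spectrum_pattern (s : seq K) :
    perm_eq s [seq (d p.1 - d p.2)%:~R | p in pattern_pairs] ->
  has_spectrum g s.
Proof.
move=> perm_s.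
apply: (has_spectrum_of_principal g_mxbr frobenius_edge_sum principal_grading).
pose X := [tuple vsproj g (pattern_vec (enum_val i)) | i < #|pattern_pairs|].
have XE (i : 'I_#|pattern_pairs|) : vsval X`_i = pattern_vec (enum_val i).
  by rewrite -tnth_nth tnth_mktuple vsprojK // pattern_vec_mem ?enum_valP.
have bX : basis_of fullv X.
  rewrite /basis_of; apply/andP; split.
    rewrite eqEsubv subvf; apply/subvP => v _.
    have -> : v = \sum_(i < #|pattern_pairs|)
        vsval v (enum_val i).1 (enum_val i).2 *: X`_i.
      apply: val_inj; change (vsval v = vsval (\sum_(i < #|pattern_pairs|) vsval v (enum_val i).1 (enum_val i).2 *: X`_i)).
      rewrite linear_sum {1}(pattern_decomp (subvsP v)) big_enum_val.
      by apply: eq_bigr => i _; rewrite linearZ /= XE.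
    by apply: rpred_sum => i _; rewrite rpredZ // memv_span // mem_nth // size_tuple.
  apply/freeP => k k0 i.
  have := congr1 (fun v : subvs_of g => vsval v (enum_val i).1 (enum_val i).2) k0.
  have := enum_valP i; rewrite inE => /andP[_ ni0].
  rewrite linear_sum summxE linear0 mxE.
  rewrite (eq_bigr (fun j => k j * (i == j)%:R)) => [|j _]; last first.
    by rewrite linearZ /= mxE XE pattern_vecE // (inj_eq enum_val_inj).
  rewrite (bigD1 i) //= eqxx mulr1 big1 ?addr0 // => j /negPf ji.
  by rewrite eq_sym ji mulr0.
pose z (i : 'I_#|pattern_pairs|) : K :=
  (d (enum_val i).1 - d (enum_val i).2)%:~R.
rewrite /eigenvalues (char_poly_eigenbasis (z := z) (vbasisP _) bX) => [|i].
  by rewrite (perm_big _ perm_s) big_image /= [RHS]big_enum_val.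
apply: val_inj; change (vsval (ad (vsproj g grading) X`_i) = vsval (z i *: X`_i)).
rewrite adE vsval_lbr // linearZ /= XE vsprojK ?grading_mem //.
apply/matrixP => a b; rewrite mxbr_grading [in RHS]mxE /z.
case: (enum_val i) => p q; rewrite !mxE /=.
have [<-|pq] := eqVneq p q; last first.
  by rewrite mul0r subr0; case: andP => [[/eqP-> /eqP->]|]; rewrite ?mulr0.
rewrite subrr mul0r mul1r; have [->|ab] := eqVneq a b; first by rewrite subrr mul0r.
have nab u : (a == u) && (b == u) = false.
  by apply/negP => /andP[/eqP au /eqP bu]; rewrite au bu eqxx in ab.
by rewrite !nab subrr mulr0.
Qed.

End PatternSpectrum.

(** * The kernel in strand coordinates *)

Section Strands.
Variables (m u : nat).
Implicit Types a b : nat * bool.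

(** Rung 0 is the centre of an odd block, its own mate, so it has one vertex only. *)
Definition strand_valid a : bool := (a.1 < m + u)%N && ((0 < a.1)%N || a.2).

(** In the tail the top blocks pair the rungs of offsets 2q, 2q + 1 and the bottom blocks those of
    offsets 2q + 1, 2q + 2. An entry below the diagonal needs a common top block and one above it a
    common bottom block; between different rungs the row is thus on the odd one. *)
Definition strand_pattern a b : bool :=
  [|| a.1 == b.1, (a.1 < m)%N && (b.1 <= m)%N
    | [&& (m <= a.1)%N, (m <= b.1)%N, odd (a.1 - m) &
          (a.1 == b.1.+1) || (b.1 == a.1.+1)]].

(* Edges go towards rung [m] in the head, and from odd to even offsets in the
   tail; the last disjunct is the edge joining the two strands at the last rung.
   The lists may contain an invalid vertex, which carries no entry. *)
Definition strand_in a : seq (nat * bool) :=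
  (if (0 < a.1)%N && ((a.1 <= m)%N || ~~ odd (a.1 - m)) then [:: (a.1.-1, a.2)] else [::])
  ++ (if (m <= a.1)%N && ~~ odd (a.1 - m) then [:: (a.1.+1, a.2)] else [::])
  ++ (if (a.1.+1 == m + u)%N && ~~ a.2 then [:: (a.1, true)] else [::]).

Definition strand_out a : seq (nat * bool) :=
  (if (a.1 < m)%N || odd (a.1 - m) then [:: (a.1.+1, a.2)] else [::])
  ++ (if (m < a.1)%N && odd (a.1 - m) then [:: (a.1.-1, a.2)] else [::])
  ++ (if (a.1.+1 == m + u)%N && a.2 then [:: (a.1, false)] else [::]).

(** A potential that drops by one along each edge; the summand [a.2] serves the edge joining the
    strands. *)
Definition strand_weight a : nat :=
  (a.2 + (if a.1 <= m then m - a.1 else odd (a.1 - m)))%N.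

Lemma strand_in_out a b : (a \in strand_in b) = (b \in strand_out a).
Proof.
have mem_if c (x y : nat * bool) : (x \in if c then [:: y] else [::]) = c && (x == y).
  by case: c; rewrite ?inE.
rewrite !mem_cat !mem_if; case: a b => [s e] [t f]; rewrite !xpair_eqE /=.
have [->|ts] := eqVneq s t.-1.
  by case: t => [|t]; case: e; case: f; rewrite /= ?(andbF, andbT, orbF); lia.
have [->|st] := eqVneq s t.+1.
  by case: e; case: f; rewrite /= ?(andbF, andbT, orbF); lia.
by case: e; case: f; rewrite /= ?(andbF, andbT, orbF); lia.
Qed.

Lemma strand_in_uniq a : (0 < u)%N -> uniq (strand_in a).
Proof.
case: a => [s []] u_gt0; rewrite /strand_in /=;
do 3!case: ifPn => ?; rewrite /= ?(in_nil, inE, xpair_eqE, orbF) ?andbF ?andbT //=; lia.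
Qed.

Lemma strand_out_uniq a : (0 < u)%N -> uniq (strand_out a).
Proof.
case: a => [s []] u_gt0; rewrite /strand_out /=;
do 3!case: ifPn => ?; rewrite /= ?(in_nil, inE, xpair_eqE, orbF) ?andbF ?andbT //=; lia.
Qed.

Lemma strand_weight_in a b :
  strand_valid b -> (0 < m)%N -> a \in strand_in b -> strand_weight a = (strand_weight b).+1.
Proof.
case: a b => [s []] [t []]; rewrite /strand_in /strand_weight /strand_valid !mem_cat /=;
do 3!case: ifPn => ?; rewrite /= ?(in_nil, inE, xpair_eqE, orbF) ?andbF ?andbT //=;
do 4?case: ifPn => ?; lia.
Qed.

End Strands.

(** * Propagation of the kernel equations along the strands *)

Section StrandKernel.
Variables (K : zmodType) (m u : nat) (X : nat * bool -> nat * bool -> K).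
Hypotheses (m_gt0 : (0 < m)%N) (u_gt1 : (1 < u)%N).
Hypothesis X_support : forall a b,
  ~~ [&& strand_valid m u a, strand_valid m u b & strand_pattern m a b] ->
  X a b = 0.
Hypothesis X_kernel : forall p q,
    strand_valid m u p -> strand_valid m u q -> strand_pattern m p q ->
  \sum_(a <- strand_in m u q) X a p = \sum_(b <- strand_out m u p) X q b.

Local Ltac vanish := apply: X_support; rewrite /strand_valid /strand_pattern /=; lia.
Local Ltac valid := rewrite /strand_valid /strand_pattern /=; lia.
Local Ltac nbrs := rewrite /strand_in /strand_out /=; do ?[case: ifPn => ? //]; lia.

(** The equation at (t, f) and (s + 1, e) has one term on each side; when s + 1 = m the second
    incoming neighbour gives an entry outside the support. *)
Lemma kernel_head s e t f : (s < m)%N -> (t < m)%N -> strand_valid m u (t, f) ->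
  X (s, e) (t, f) = X (s.+1, e) (t.+1, f).
Proof.
move=> sm tm vt.
have := X_kernel vt (_ : strand_valid m u (s.+1, e)).
have -> : strand_out m u (t, f) = [:: (t.+1, f)] by nbrs.
rewrite big_seq1 => <- //; try valid.
have [sm'|sm'] := eqVneq s.+1 m; last first.
  have -> : strand_in m u (s.+1, e) = [:: (s, e)] by nbrs.
  by rewrite big_seq1.
have -> : strand_in m u (s.+1, e) = [:: (s, e); (s.+2, e)] by nbrs.
rewrite big_cons big_seq1 [X in _ + X](_ : _ = 0) ?addr0 //; vanish.
Qed.

Lemma kernel_start t f : (t < m)%N -> strand_valid m u (t, f) ->
  X (0, true) (t.+1, f) = 0.
Proof.
move=> tm vt; have := X_kernel vt (_ : strand_valid m u (0, true)).
have -> : strand_out m u (t, f) = [:: (t.+1, f)] by nbrs.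
have -> : strand_in m u (0, true) = [::] by nbrs.
rewrite big_nil big_seq1 => <- //; valid.
Qed.

(** Moving back along the strands brings the row to rung 0, where [kernel_start] applies, except for
    the column (1, false): its predecessor (0, false) is no vertex. This is the excluded case. *)
Lemma kernel_head_lt s e t f : (s < t <= m)%N -> (t != s.+1) || ~~ e || f ->
  X (s, e) (t, f) = 0.
Proof.
elim: s e t f => [|s IHs] e [|t] f //= stm nex.
  case: e nex => nex; last vanish.
  by apply: kernel_start; move: nex stm; rewrite /strand_valid /=; case: f; lia.
have [vt|nvt] := boolP (strand_valid m u (t, f)); last first.
  by move: nvt stm; rewrite /strand_valid /=; lia.
rewrite -kernel_head //; try lia.
by apply: IHs; lia.
Qed.

(** Moving forward brings the row to rung m while the column stays before it, outside the
    support. *)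
Lemma kernel_head_gt s e t f : (t < s <= m)%N -> X (s, e) (t, f) = 0.
Proof.
move=> tsm; have [n sn] : exists n, m = (s + n)%N by exists (m - s)%N; lia.
elim: n s t tsm sn => [|n IHn] s t tsm sn; first vanish.
have [vt|nvt] := boolP (strand_valid m u (t, f)); last first.
  by apply: X_support; rewrite (negPf nvt) andbF.
by rewrite kernel_head //; [apply: IHn|..]; lia.
Qed.

Lemma kernel_head_rung s e f :
    (s <= m)%N -> strand_valid m u (s, e) -> strand_valid m u (s, f) ->
  X (s, e) (s, f) = X (m, e) (m, f).
Proof.
move=> sm; have [n sn] : exists n, m = (s + n)%N by exists (m - s)%N; lia.
elim: n s sm sn => [|n IHn] s sm sn ve vf; first by rewrite sn addn0.
rewrite kernel_head //; try lia.
by apply: IHn; try lia; move: ve vf; valid.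
Qed.

(** Moved back to rung 0, the entry has the invalid row (0, false). *)
Lemma kernel_rung_false_true : X (m, false) (m, true) = 0.
Proof.
rewrite -(@kernel_head_rung 1) //; try valid.
rewrite -kernel_head //; try valid.
vanish.
Qed.

(* Entries between the rungs [m + s] and [m + s + 1]: the support forces the
   row on the rung of odd offset. *)
Definition tail_entry s e f :=
  if odd s then X ((m + s)%N, e) ((m + s).+1, f)
  else X ((m + s).+1, e) ((m + s)%N, f).

(** Before the last rung, vertices of odd offset are sources and those of positive even offset
    sinks, so one side of the equation on a single rung is empty. *)
Lemma kernel_tail_step s e f : (s.+2 < u)%N ->
  tail_entry s e f + tail_entry s.+1 e f = 0.
Proof.
move=> su; have := X_kernel (_ : strand_valid m u ((m + s).+1, f))
                            (_ : strand_valid m u ((m + s).+1, e)).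
rewrite /tail_entry /= addnS; case: (boolP (odd s)) => /= odds.
  have -> : strand_out m u ((m + s).+1, f) = [::] by nbrs.
  have -> : strand_in m u ((m + s).+1, e) = [:: ((m + s)%N, e); ((m + s).+2, e)] by nbrs.
  by rewrite big_nil big_cons big_seq1; apply; valid.
have -> : strand_out m u ((m + s).+1, f) = [:: ((m + s).+2, f); ((m + s)%N, f)] by nbrs.
have -> : strand_in m u ((m + s).+1, e) = [::] by nbrs.
by rewrite big_nil big_cons big_seq1 addrC => <- //; valid.
Qed.

Lemma kernel_tail_first e f : X (m.-1, e) (m, f) + tail_entry 0 e f = 0.
Proof.
have := X_kernel (_ : strand_valid m u (m, f)) (_ : strand_valid m u (m, e)).
have -> : strand_out m u (m, f) = [::] by nbrs.
have -> : strand_in m u (m, e) = [:: (m.-1, e); (m.+1, e)] by nbrs.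
by rewrite /tail_entry /= addn0 big_nil big_cons big_seq1; apply; valid.
Qed.

Local Notation L := (m + u).-1.

(* Only for [(e, f) = (true, false)] does the last rung give an equation in a
   single unknown; the other three labels are killed from the head side. *)
Lemma kernel_tail_last e f :
  tail_entry u.-2 e f = 0 <->
  (if e then 0 else X (L, true) (L, f)) = (if f then X (L, e) (L, false) else 0).
Proof.
have := X_kernel (_ : strand_valid m u (L, f)) (_ : strand_valid m u (L, e)).
have EL : ((m + u.-2).+1 = L)%N by lia.
have EL' : ((m + u.-2) = L.-1)%N by lia.
rewrite /tail_entry EL EL'; case: (boolP (odd u.-2)) => /= oddu.
  have -> : strand_out m u (L, f) = if f then [:: (L, false)] else [::] by nbrs.
  have -> : strand_in m u (L, e) = (L.-1, e) :: (L.+1, e) :: if e then [::] else [:: (L, true)] by nbrs.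
  rewrite !big_cons [X (L.+1, e) _](_ : _ = 0); last vanish.
  rewrite add0r => E.
  have {}E : X (L.-1, e) (L, f) + (if e then 0 else X (L, true) (L, f))
      = (if f then X (L, e) (L, false) else 0).
    by move: E; case: e; case: f; rewrite ?big_nil ?big_seq1; apply; valid.
  rewrite -E; split=> [->|/eqP]; first by rewrite add0r.
  by rewrite eq_sym -subr_eq0 addrK => /eqP.
have -> : strand_out m u (L, f) = (L.+1, f) :: (L.-1, f) :: if f then [:: (L, false)] else [::] by nbrs.
have -> : strand_in m u (L, e) = if e then [::] else [:: (L, true)] by nbrs.
rewrite !big_cons [X _ (L.+1, f)](_ : _ = 0); last vanish.
rewrite add0r => E.
have {}E : (if e then 0 else X (L, true) (L, f))
    = X (L, e) (L.-1, f) + (if f then X (L, e) (L, false) else 0).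
  by move: E; case: e; case: f; rewrite ?big_nil ?big_seq1; apply; valid.
rewrite E; split=> [->|/eqP]; first by rewrite add0r.
by rewrite -subr_eq0 addrK => /eqP.
Qed.

Lemma tail_entry_eq0 s e f : (s.+1 < u)%N -> tail_entry s e f = 0.
Proof.
have [/andP[-> /negPf->]|nef] := boolP (e && ~~ f).
  move=> su; have [n sn] : exists n, u.-2 = (s + n)%N by exists (u.-2 - s)%N; lia.
  elim: n s su sn => [|n IHn] s su sn.
    by rewrite addn0 in sn; rewrite -sn; apply/(kernel_tail_last true false).
  have := @kernel_tail_step s true false; rewrite (IHn s.+1) ?addr0; [apply|..]; lia.
elim: s => [|s IHs] su.
  have := kernel_tail_first e f; rewrite kernel_head_lt ?add0r //; first lia.
  by move: nef; case: e; case: f; rewrite ?orbT //=; lia.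
have := @kernel_tail_step s e f; rewrite IHs ?add0r; [apply|]; lia.
Qed.

(** The case left open by [kernel_head_lt]: it is moved forward to rung m and settled there by the
    vanishing of the tail. *)
Lemma kernel_head_next s : (s < m)%N -> X (s, true) (s.+1, false) = 0.
Proof.
move=> sm; have [n sn] : exists n, m = (s.+1 + n)%N by exists (m - s.+1)%N; lia.
elim: n s sm sn => [|n IHn] s sm sn; last first.
  by rewrite kernel_head; [apply: IHn|..]; try lia; valid.
have := kernel_tail_first true false; rewrite tail_entry_eq0 ?addr0; last lia.
have -> : m.-1 = s by lia.
by rewrite [X in X = _ -> _](_ : _ = X (s, true) (s.+1, false)) // sn addn0.
Qed.

(** The equation for two consecutive rungs, with p on the odd one, equates their rung entries; all
    its other terms leave the support. *)
Lemma kernel_tail_rung s e f :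
  (s < u)%N -> X ((m + s)%N, e) ((m + s)%N, f) = X (m, e) (m, f).
Proof.
elim: s => [|s IHs] su; first by rewrite addn0.
rewrite -IHs; last lia.
case: (boolP (odd s)) => odds.
  have := X_kernel (_ : strand_valid m u ((m + s)%N, f))
                   (_ : strand_valid m u ((m + s).+1, e)).
  have -> : strand_out m u ((m + s)%N, f) = [:: ((m + s).+1, f); ((m + s).-1, f)] by nbrs.
  have -> : strand_in m u ((m + s).+1, e) = [:: ((m + s)%N, e), ((m + s).+2, e) &
       if ((m + s).+2 == m + u)%N && ~~ e then [:: ((m + s).+1, true)] else [::]] by nbrs.
  rewrite !big_cons big_nil addr0 addnS.
  rewrite [X ((m + s).+2, e) _](_ : _ = 0); last vanish.
  rewrite [X _ ((m + s).-1, f)](_ : _ = 0); last vanish.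
  rewrite add0r addr0 big_seq big1 ?addr0 => [<- //|a]; try valid.
  by case: ifP => // _; rewrite inE => /eqP ->; vanish.
have := X_kernel (_ : strand_valid m u ((m + s).+1, f))
                 (_ : strand_valid m u ((m + s)%N, e)).
have -> : strand_out m u ((m + s).+1, f) = [:: ((m + s).+2, f), ((m + s)%N, f) &
       if ((m + s).+2 == m + u)%N && f then [:: ((m + s).+1, false)] else [::]] by nbrs.
have -> : strand_in m u ((m + s)%N, e) = [:: ((m + s).-1, e); ((m + s).+1, e)] by nbrs.
rewrite !big_cons big_nil addr0 addnS.
rewrite [X ((m + s).-1, e) _](_ : _ = 0); last vanish.
rewrite [X _ ((m + s).+2, f)](_ : _ = 0); last vanish.
rewrite !add0r [X in _ + X]big_seq [X in _ + X]big1 ?addr0 => [-> //|a]; try valid.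
by case: ifP => // _; rewrite inE => /eqP ->; vanish.
Qed.

(** Now [kernel_tail_last] is read in the other direction: as tail entries vanish, the joining edge
    yields relations within the last rung, here and in [kernel_rung_diag]. *)
Lemma kernel_rung_true_false : X (m, true) (m, false) = 0.
Proof.
have /(kernel_tail_last false false) := @tail_entry_eq0 u.-2 false false ltac:(lia).
have -> : L = (m + u.-1)%N by lia.
by rewrite kernel_tail_rung //; lia.
Qed.

Lemma kernel_rung_diag : X (m, true) (m, true) = X (m, false) (m, false).
Proof.
have /(kernel_tail_last false true) := @tail_entry_eq0 u.-2 false true ltac:(lia).
have -> : L = (m + u.-1)%N by lia.
by rewrite !kernel_tail_rung //; lia.
Qed.

Lemma kernel_offdiag a b : a != b -> X a b = 0.
Proof.
move=> ab; have [|nS] := boolP [&& strand_valid m u a, strand_valid m u b & strand_pattern m a b].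
  case: a b ab => [s e] [t f] ab /and3P[va vb S].
  have [st|st] := eqVneq s t.
    have -> : X (s, e) (t, f) = X (m, e) (m, f).
      rewrite -st; have [sm|ms] := leqP s m; last first.
        have -> : s = (m + (s - m))%N by lia.
        by apply: kernel_tail_rung; move: va; rewrite /strand_valid /=; lia.
      by apply: kernel_head_rung => //; rewrite st.
    move: ab; rewrite st xpair_eqE eqxx /=; case: e {va S}; case: f {vb} => // _.
      exact: kernel_rung_true_false.
    exact: kernel_rung_false_true.
  have [ts|ts] := ltnP t s.
    have [sm|ms] := leqP s m; first by apply: kernel_head_gt; lia.
    have := @tail_entry_eq0 (t - m) e f; rewrite /tail_entry.
    move: S va vb; rewrite /strand_pattern /strand_valid /= => S va vb.
    have -> : odd (t - m) = false by lia.
    have -> : ((m + (t - m)).+1 = s)%N by lia.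
    have -> : ((m + (t - m)) = t)%N by lia.
    by apply; lia.
  have [tm|mt] := leqP t m.
    have [nex|] := boolP ((t != s.+1) || ~~ e || f).
      by apply: kernel_head_lt => //; lia.
    case: e va S ab => // va S ab; last by rewrite orbT.
    case: f vb S ab => // vb S ab; first by rewrite orbT.
    by rewrite !orbF negbK => /eqP->; apply: kernel_head_next; lia.
  have := @tail_entry_eq0 (s - m) e f; rewrite /tail_entry.
  move: S va vb; rewrite /strand_pattern /strand_valid /= => S va vb.
  have -> : odd (s - m) = true by lia.
  have -> : ((m + (s - m)).+1 = t)%N by lia.
  have -> : ((m + (s - m)) = s)%N by lia.
  by apply; lia.
exact: X_support.
Qed.

Lemma kernel_diag a : strand_valid m u a -> X a a = X (m, true) (m, true).
Proof.
case: a => s e va; have -> : X (s, e) (s, e) = X (m, e) (m, e).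
  have [sm|ms] := leqP s m; first exact: kernel_head_rung.
  have -> : s = (m + (s - m))%N by lia.
  by apply: kernel_tail_rung; move: va; rewrite /strand_valid /=; lia.
by case: e {va}; rewrite ?kernel_rung_diag.
Qed.

End StrandKernel.

(** * Positions and strands *)

Section Positions.
Local Open Scope nat_scope.
Variable m : nat.
Hypothesis m_gt0 : 0 < m.
Local Notation k := (2 * m - 1)%N.

(* The mate of position [i] in a reflected block is found by reversing the block,
   so that a strand alternates between the two halves of the head, then between
   the two positions of consecutive rungs of the tail. Rung [m] is the pair
   [k], [k.+1], and [(0, false)] is the only invalid pair below rung [m + u]. *)
Definition strand_of (i : nat) : nat * bool :=
  if (i < m)%N then ((m - (i + ~~ odd i))%N, ~~ odd i)
  else if (i <= 2 * m)%N then ((i + odd i - m)%N, ~~ odd i)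
  else ((m + (i - k) %/ 2)%N, odd (i - k) (+) odd ((i - k) %/ 2)).

Definition strand_pos (a : nat * bool) : nat :=
  if (a.1 <= m)%N then
    let rho := (m - a.1)%N in
    if odd rho then (rho - a.2)%N else (k + a.2 - rho)%N
  else (k + 2 * (a.1 - m) + (a.2 (+) odd (a.1 - m)))%N.

Lemma strand_of_valid u i : (i < k + 2 * u)%N -> strand_valid m u (strand_of i).
Proof.
move=> iu; rewrite /strand_of /strand_valid.
case: ifPn => i1 /=; [|case: ifPn => i2 /=]; lia.
Qed.

Lemma strand_ofK i : strand_pos (strand_of i) = i.
Proof.
rewrite /strand_of; case: (ltnP i m) => i1; [|case: (leqP i (2 * m)) => i2];
by rewrite /strand_pos /=; do ?[case: ifPn => ?]; lia.
Qed.

Lemma strand_posP u a : strand_valid m u a ->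
  (strand_pos a < k + 2 * u)%N && (strand_of (strand_pos a) == a).
Proof.
case: a => s []; rewrite /strand_valid /strand_pos /= => va;
(case: ifPn => ?; [case: ifPn => ?|]);
rewrite /strand_of; (case: ifPn => ?; [|case: ifPn => ?]); rewrite xpair_eqE; lia.
Qed.

(** The length of the last block does not appear, so both families share this pattern and differ
    only in the matrix size. *)
Definition seaweed_pattern (i j : nat) : bool :=
  ((i <= j)%N || ((i < k)%N && (j < k)%N)
     || [&& (k <= i)%N, (k <= j)%N & ((i - k) %/ 4 == (j - k) %/ 4)%N])
  && ((j <= i)%N || ((i < k.+2)%N && (j < k.+2)%N)
     || [&& (k.+2 <= i)%N, (k.+2 <= j)%N & ((i - k.+2) %/ 4 == (j - k.+2) %/ 4)%N]).

Lemma rung_head i : (i <= 2 * m)%N ->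
  ((strand_of i).1 <= m)%N /\ ((strand_of i).1 < m)%N = (i < k)%N.
Proof.
by rewrite /strand_of; case: ifPn => i1; [|case: ifPn => i2] => /=; lia.
Qed.

Lemma rung_tail i : (k <= i)%N -> (strand_of i).1 = (m + (i - k) %/ 2)%N.
Proof.
by rewrite /strand_of; case: ifPn => i1; [|case: ifPn => i2] => /=; lia.
Qed.

Lemma tail_blocks t t' :
  ((t <= t')%N || (t %/ 4 == t' %/ 4)%N) &&
    ((t' <= t)%N || (t < 2)%N && (t' < 2)%N
       || [&& (1 < t)%N, (1 < t')%N & ((t - 2) %/ 4 == (t' - 2) %/ 4)%N])
  = (t %/ 2 == t' %/ 2)%N
    || odd (t %/ 2) && ((t %/ 2 == (t' %/ 2).+1)%N || (t' %/ 2 == (t %/ 2).+1)%N).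
Proof.
(* Here 2q + o is the rung offset. For x < 2 the last quotient is the default 0, and the guards
   [1 < t] discard it. *)
have quarters x : exists q o e, [/\ x = (4 * q + 2 * (o : bool) + (e : bool))%N,
    x %/ 2 = (2 * q + o)%N, x %/ 4 = q, odd (x %/ 2) = o
    & ((x - 2) %/ 4 = if o then q else q.-1)%N].
  exists (x %/ 4)%N, (odd (x %/ 2)), (odd x); split; try case: ifP; lia.
have [q [o [e [-> -> -> -> ->]]]] := quarters t.
have [q' [o' [e' [-> -> -> _ ->]]]] := quarters t'.
by case: o; case: e; case: o'; case: e' => /=; lia.
Qed.

Lemma seaweed_patternE i j :
  seaweed_pattern i j = strand_pattern m (strand_of i) (strand_of j).
Proof.
rewrite /seaweed_pattern /strand_pattern.
case: (leqP k i) => ki; case: (leqP k j) => kj.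
- rewrite !rung_tail // leq_addr leq_addr addKn /=.
  have := tail_blocks (i - k) (j - k); rewrite -!subnDA addn2.
  have -> : (i - k <= j - k) = (i <= j) by lia.
  have -> : (j - k <= i - k) = (j <= i) by lia.
  have -> : (i - k < 2) = (i < k.+2) by lia.
  have -> : (j - k < 2) = (j < k.+2) by lia.
  have -> : (1 < i - k) = (k.+2 <= i) by lia.
  have -> : (1 < j - k) = (k.+2 <= j) by lia.
  have -> : (m + (i - k) %/ 2 < m) = false by lia.
  rewrite orbF => ->.
  by rewrite eqn_add2l -!addnS !eqn_add2l.
- have [ji jm] : (strand_of j).1 <= m /\ ((strand_of j).1 < m) = true.
    by have [->] := @rung_head j ltac:(lia); rewrite kj.
  rewrite (rung_tail ki).
  have -> : (m <= (strand_of j).1) = false by lia.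
  rewrite andbF /= !orbF. lia.
- have [ij im] : (strand_of i).1 <= m /\ ((strand_of i).1 < m) = true.
    by have [->] := @rung_head i ltac:(lia); rewrite ki.
  rewrite (rung_tail kj) im.
  have -> : (m <= (strand_of i).1) = false by lia.
  have -> : (i < k.+2) = true by lia.
  rewrite /= ?andbF ?orbF. lia.
- have [_ im] := @rung_head i ltac:(lia); have [jm _] := @rung_head j ltac:(lia).
  rewrite im ki jm /=. lia.
Qed.

End Positions.

(** * Return from strand coordinates to matrices *)

Section StrandSpectrum.
Variables (K : numFieldType) (m u : nat).
Hypotheses (m_gt0 : (0 < m)%N) (u_gt1 : (1 < u)%N).
Local Notation n := (2 * m - 1 + 2 * u)%N.
Variable g : {vspace 'M[K]_n}.
Hypothesis g_mxbr : forall x y, x \in g -> y \in g -> mxbr x y \in g.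
Hypothesis gP : forall x : 'M[K]_n,
  x \in g <-> \tr x = 0 /\ forall i j : 'I_n, ~~ seaweed_pattern m i j -> x i j = 0.

Local Notation strand i := (strand_of m (nat_of_ord i)).

(** Each sum has at most one term; the sums make the entry 0 at invalid pairs. *)
Definition strand_entry (x : 'M[K]_n) (a b : nat * bool) : K :=
  \sum_(i : 'I_n | strand i == a) \sum_(j : 'I_n | strand j == b) x i j.

Lemma strand_inj : injective (fun i : 'I_n => strand i).
Proof. by move=> i j /(congr1 (strand_pos m)); rewrite !strand_ofK // => /val_inj. Qed.

Lemma strand_entryE x i j : strand_entry x (strand i) (strand j) = x i j.
Proof.
by rewrite /strand_entry (big_pred1 i) => [|a]; rewrite ?(inj_eq strand_inj) //;
   rewrite (big_pred1 j) // => a; rewrite (inj_eq strand_inj).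
Qed.

Lemma strand_surj a : strand_valid m u a -> exists i : 'I_n, strand i = a.
Proof.
by move=> /(strand_posP m_gt0)/andP[ltan /eqP aE]; exists (Ordinal ltan).
Qed.

Lemma sum_strand (L : seq (nat * bool)) (G : 'I_n -> K) : uniq L ->
  \sum_(i : 'I_n | strand i \in L) G i = \sum_(a <- L) \sum_(i : 'I_n | strand i == a) G i.
Proof.
move=> uL; rewrite [RHS]big_seq.
rewrite (exchange_big_dep (fun i : 'I_n => strand i \in L)) /=; last first.
  by move=> a i aL /eqP->.
apply: eq_bigr => i iL; rewrite big_mkcond (bigD1_seq (strand i)) //= eqxx iL.
by rewrite big1 ?addr0 // => a /negPf ai; rewrite [strand i == a]eq_sym ai andbF.
Qed.

Lemma strand_kernel_scalar (x : 'M[K]_n) :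
    (forall i j : 'I_n, ~~ seaweed_pattern m i j -> x i j = 0) ->
    (forall p q : 'I_n, seaweed_pattern m p q ->
      \sum_(i | strand i \in strand_in m u (strand q)) x i p
      = \sum_(j | strand p \in strand_in m u (strand j)) x q j) ->
  exists c, x = c%:M.
Proof.
move=> xS xE; pose X := strand_entry x.
have X_S a b : ~~ [&& strand_valid m u a, strand_valid m u b & strand_pattern m a b] ->
    X a b = 0.
  move=> nab; rewrite /X /strand_entry big1 // => i /eqP ia; rewrite big1 // => j /eqP jb.
  apply: xS; apply: contra nab; rewrite seaweed_patternE // ia jb => ->.
  by rewrite -ia -jb !strand_of_valid.
have X_E p q : strand_valid m u p -> strand_valid m u q -> strand_pattern m p q ->
    \sum_(a <- strand_in m u q) X a p = \sum_(b <- strand_out m u p) X q b.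
  move=> /strand_surj[i <-] /strand_surj[j <-]; rewrite -seaweed_patternE // => /xE.
  under [X in _ = X -> _]eq_bigl do rewrite strand_in_out.
  rewrite !sum_strand ?strand_in_uniq ?strand_out_uniq //; try lia.
  move=> E; transitivity (\sum_(a <- strand_in m u (strand j)) \sum_(i0 : 'I_n | strand i0 == a) x i0 i).
    apply: eq_bigr => a _; apply: eq_bigr => b _.
    by rewrite (big_pred1 i) // => c; rewrite (inj_eq strand_inj).
  rewrite E; apply: eq_bigr => a _.
  by rewrite /X /strand_entry [RHS](big_pred1 j) // => c; rewrite (inj_eq strand_inj).
exists (X (m, true) (m, true)); apply/matrixP => i j.
rewrite -strand_entryE mxE; have [->|ij] := eqVneq i j.
  rewrite mulr1n; apply: (kernel_diag m_gt0 u_gt1 X_S X_E).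
  exact: strand_of_valid.
rewrite mulr0n; apply: (kernel_offdiag m_gt0 u_gt1 X_S X_E).
by rewrite (inj_eq strand_inj).
Qed.

Definition strand_diff (p : 'I_n * 'I_n) : int :=
  (strand_weight m (strand p.1))%:Z - (strand_weight m (strand p.2))%:Z.

Lemma has_spectrum_strand (i0 : 'I_n) (s : seq int) :
    perm_eq s [seq strand_diff p
      | p in pattern_pairs (fun i j : 'I_n => seaweed_pattern m i j) i0] ->
  has_spectrum g [seq z%:~R | z <- s].
Proof.
move=> perm_s; pose phi (i j : 'I_n) := strand i \in strand_in m u (strand j).
pose d (i : 'I_n) : int := (strand_weight m (strand i))%:Z.
apply: (@has_spectrum_pattern K n g (fun i j : 'I_n => seaweed_pattern m i j) phi d i0) => //.
- by move=> i; rewrite /= seaweed_patternE // /strand_pattern eqxx.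
- move=> i j /(strand_weight_in (strand_of_valid m_gt0 (ltn_ord j))) ij.
  by rewrite /d ij // -addn1 PoszD addrC addKr.
- exact: strand_kernel_scalar.
by apply: perm_trans (perm_map _ perm_s) _; rewrite -map_comp.
Qed.

End StrandSpectrum.

(** * Multiplicities *)

Section Multiplicities.
Local Open Scope nat_scope.

Lemma sum_interval lo hi a b :
  \sum_(lo <= s < hi) (a <= s < b) = minn hi b - maxn lo a.
Proof.
elim: hi => [|hi IHhi]; first by rewrite big_geq //; lia.
have [lohi|hilo] := leqP lo hi; last by rewrite big_geq //; lia.
rewrite big_nat_recr //= IHhi; lia.
Qed.

Lemma sum_pred1_int lo hi (c : int) :
  \sum_(lo <= s < hi) (s%:Z == c)%R = (lo%:Z <= c < hi%:Z)%R.
Proof.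
elim: hi => [|hi IHhi]; first by rewrite big_geq //; lia.
have [lohi|hilo] := leqP lo hi; last by rewrite big_geq //; lia.
rewrite big_nat_recr //= IHhi; lia.
Qed.

Variables (m u : nat).
Hypotheses (m_gt0 : 0 < m) (u_gt1 : 1 < u).

Lemma sum_strand_of (G : nat * bool -> nat) :
  \sum_(i < 2 * m - 1 + 2 * u) G (strand_of m i)
  = \sum_(0 <= s < m + u) G (s, true) + \sum_(1 <= s < m + u) G (s, false).
Proof.
pose r := [seq (s, true) | s <- index_iota 0 (m + u)]
       ++ [seq (s, false) | s <- index_iota 1 (m + u)].
have -> : \sum_(0 <= s < m + u) G (s, true) + \sum_(1 <= s < m + u) G (s, false)
    = \sum_(a <- r) G a by rewrite big_cat !big_map.
rewrite -(big_mkord predT (fun i => G (strand_of m i))) -(big_map (strand_of m) predT G).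
apply/perm_big/uniq_perm.
- by rewrite map_inj_uniq ?iota_uniq //; apply: can_inj (strand_ofK m_gt0).
- rewrite cat_uniq !map_inj_uniq ?iota_uniq /=; try by move=> ? ? [].
  by rewrite andbT; apply/hasPn => _ /mapP[s _ ->]; apply/negP => /mapP[].
move=> a; apply/mapP/idP => [[j]|].
  rewrite mem_index_iota => ju ->; have := strand_of_valid m_gt0 (u := u) (i := j).
  case: (strand_of m j) => s e; rewrite mem_cat => /(_ ju) va.
  case: e va => va; apply/orP; [left|right]; apply/mapP; exists s => //;
  by move: va; rewrite mem_index_iota /strand_valid /=; lia.
rewrite mem_cat => ra; have va : strand_valid m u a.
  by case/orP: ra => /mapP[s]; rewrite mem_index_iota /strand_valid => ss -> /=; lia.
have /andP[pa /eqP Ea] := strand_posP m_gt0 va.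
by exists (strand_pos m a); rewrite ?mem_index_iota.
Qed.

Definition strand_count (a b : nat * bool) (z : int) : nat :=
  strand_pattern m a b &&
  ((strand_weight m a)%:Z - (strand_weight m b)%:Z == z)%R.

(** The weights leave a single candidate for the column rung, namely z + s - e + f. *)
Lemma sum_strand_count_head lo s e f z : s < m ->
  \sum_(lo <= t < m + u) strand_count (s, e) (t, f) z
  = (lo%:Z <= z + s%:Z - (e : nat)%:Z + (f : nat)%:Z <= m%:Z)%R.
Proof.
move=> sm; rewrite (eq_big_nat _ _ (F2 := fun t =>
    (t%:Z == z + s%:Z - (e : nat)%:Z + (f : nat)%:Z)%R && (t <= m) : nat)).
  case: (leqP lo m) => lom; last first.
    rewrite big_nat big1 => [|t]; lia.
  rewrite (big_cat_nat (n := m.+1)) //=; try lia.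
  rewrite [X in _ + X]big_nat [X in _ + X]big1 => [|t]; last lia.
  rewrite (eq_big_nat _ _ (F2 := fun t =>
    (t%:Z == z + s%:Z - (e : nat)%:Z + (f : nat)%:Z)%R : nat)); last lia.
  rewrite sum_pred1_int; lia.
move=> t _; rewrite /strand_count /strand_pattern /strand_weight /=.
case: e; case: f => /=; do 2?[case: ifPn => ?]; lia.
Qed.

(** The rung itself gives the difference e - f. From an odd rung, the two neighbours, or just one at
    the end of the tail, give e - f + 1. *)
Lemma sum_strand_count_tail lo s e f z : lo <= m -> m <= s < m + u ->
  \sum_(lo <= t < m + u) strand_count (s, e) (t, f) z
  = ((e : nat)%:Z - (f : nat)%:Z == z)%R
    + odd (s - m) * (s.+1 < m + u).+1 * ((e : nat)%:Z - (f : nat)%:Z + 1 == z)%R.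
Proof.
move=> lom ms; rewrite (eq_big_nat _ _ (F2 := fun t =>
    (t%:Z == s%:Z)%R * ((e : nat)%:Z - (f : nat)%:Z == z)%R
    + (t%:Z == s%:Z + 1)%R * (odd (s - m) * ((e : nat)%:Z - (f : nat)%:Z + 1 == z)%R)
    + (t%:Z == s%:Z - 1)%R * (odd (s - m) * ((e : nat)%:Z - (f : nat)%:Z + 1 == z)%R))).
  rewrite !big_split -!big_distrl /= !sum_pred1_int.
  have -> : (lo%:Z <= s%:Z < (m + u)%:Z)%R by lia.
  have -> : ((lo%:Z <= s%:Z + 1 < (m + u)%:Z)%R = (s.+1 < m + u)) by lia.
  case: (boolP (odd (s - m))) => oddsm; last by rewrite !mul0n !muln0 !addn0 mul1n.
  have -> : (lo%:Z <= s%:Z - 1 < (m + u)%:Z)%R by lia.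
  by rewrite /= !mul1n mulSn; lia.
move=> t _; rewrite /strand_count /strand_pattern.
have weight_tail s' e' : m <= s' -> strand_weight m (s', e') = e' + odd (s' - m).
  by rewrite /strand_weight /=; case: ifP => //; lia.
rewrite weight_tail; last lia.
have [mt|tm] := leqP m t; last first.
  have -> : [|| s == t, (s < m) && (t <= m) | [&& m <= s, false, odd (s - m)
     & (s == t.+1) || (t == s.+1)]] = false by lia.
  have -> : (t%:Z == s%:Z)%R = false by lia.
  have -> : (t%:Z == s%:Z + 1)%R = false by lia.
  case: (boolP (odd (s - m))) => odds; last by rewrite !mul0n !muln0.
  by have -> : (t%:Z == s%:Z - 1)%R = false by lia.
rewrite weight_tail //.
have [ts|nts] := eqVneq s t.
  have -> : (t%:Z == s%:Z)%R by lia.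
  have -> : (t%:Z == s%:Z + 1)%R = false by lia.
  have -> : (t%:Z == s%:Z - 1)%R = false by lia.
  by rewrite !mul0n !addn0 /= mul1n ts; congr nat_of_bool; lia.
have -> : (t%:Z == s%:Z)%R = false by lia.
have -> : (t%:Z == s%:Z + 1)%R = (t == s.+1) by lia.
have -> : (t%:Z == s%:Z - 1)%R = (s == t.+1) by lia.
case: (boolP (odd (s - m))) => odds; last by rewrite !mul0n !muln0 /=; lia.
have [st|nst] := eqVneq s t.+1; have [ts|nts'] := eqVneq t s.+1; try lia.
- by rewrite mul0n !mul1n !add0n /=; congr nat_of_bool; lia.
- by rewrite mul0n !mul1n !addn0 /=; congr nat_of_bool; lia.
by rewrite /= !andbF; lia.
Qed.

Lemma sum_odd v : \sum_(0 <= r < v) odd r * 2 = v - odd v.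
Proof.
elim: v => [|v IHv]; first by rewrite big_geq.
by rewrite big_nat_recr //= IHv; case: (boolP (odd v)) => /=; lia.
Qed.

(** Each of the u - 1 pairs of consecutive tail rungs counts once, with its odd rung as row. *)
Lemma sum_strand_count lo lo' e f z : lo <= 1 -> lo' <= 1 ->
  \sum_(lo <= s < m + u) \sum_(lo' <= t < m + u) strand_count (s, e) (t, f) z
  = \sum_(lo <= s < m) (lo'%:Z <= z + s%:Z - (e : nat)%:Z + (f : nat)%:Z <= m%:Z)%R
    + u * ((e : nat)%:Z - (f : nat)%:Z == z)%R
    + u.-1 * ((e : nat)%:Z - (f : nat)%:Z + 1 == z)%R.
Proof.
move=> lo1 lo1'; rewrite (big_cat_nat (n := m)) /=; try lia.
rewrite -addnA; congr addn.
  by apply: eq_big_nat => s sm; rewrite sum_strand_count_head; lia.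
rewrite (eq_big_nat _ _ (fun s sm => sum_strand_count_tail e f z (leq_trans lo1' m_gt0) sm)).
rewrite big_split /= sum_nat_const_nat addKn; congr (_ + _).
rewrite -big_distrl /=; congr (_ * _).
rewrite -{1}[m]add0n big_addn addKn -{1}(prednK (ltnW u_gt1)) big_nat_recr //=.
rewrite (eq_big_nat _ _ (F2 := fun r => odd r * 2)) => [|r ru]; last first.
  by rewrite addnK; have -> : (r + m).+1 < m + u by lia.
rewrite sum_odd addnK; have -> : (u.-1 + m).+1 < m + u = false by lia.
by case: (boolP (odd u.-1)) => oddu /=; lia.
Qed.

(** The multiplicity of -w and of w + 1. For -w, the first four terms count the head rows by strand
    labels; the tail adds 3u - 1 zeros, one of them removed by the trace, and u times -1. For 2 <= w
    <= m - 2 the value is 4 (m - w) - 2. For m > 2 truncated subtraction gives 3 at w = m - 1 and 1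
    at w = m; for m <= 2 it already acts at w <= 1, whence the separate cases of k. *)
Definition strand_mult (w : nat) : nat :=
  (m - w) + (m - w.+2) + (m - maxn 1 w.-1) + (m - w.+1)
  + (w == 0) * (3 * u - 2) + (w == 1) * u.

Lemma sum_interval_eq (P : nat -> bool) lo a b c :
    (forall s, lo <= s < m -> P s = (a <= s < b)) -> minn m b - maxn lo a = c ->
  \sum_(lo <= s < m) P s = c.
Proof. by move=> PE <-; rewrite -sum_interval; apply: eq_big_nat => s /PE ->. Qed.

Lemma total_strand_count z :
  \sum_(i < 2 * m - 1 + 2 * u) \sum_(j < 2 * m - 1 + 2 * u)
     strand_count (strand_of m i) (strand_of m j) z
  = strand_mult (if (0 < z)%R then `|z - 1|%N else `|z|%N) + (z == 0%R).
Proof.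
under eq_bigr do rewrite (sum_strand_of (fun b => strand_count _ b z)).
rewrite big_split /=.
rewrite (sum_strand_of (fun a => \sum_(0 <= t < m + u) strand_count a (t, true) z)).
rewrite (sum_strand_of (fun a => \sum_(1 <= t < m + u) strand_count a (t, false) z)).
rewrite !sum_strand_count //.
case: z => w.
  rewrite (@sum_interval_eq _ 0 0 (m.+1 - w) (minn m (m.+1 - w))); last lia; last first.
    by move=> s sm /=; lia.
  rewrite (@sum_interval_eq _ 1 1 (m - w) (m - w - 1)); last lia; last first.
    by move=> s sm /=; lia.
  rewrite (@sum_interval_eq _ 0 (2 - w) (m.+2 - w) (minn m (m.+2 - w) - (2 - w))); last lia; last first.
    by move=> s sm /=; lia.
  rewrite (@sum_interval_eq _ 1 1 (m.+1 - w) (minn m (m.+1 - w) - 1)); last lia; last first.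
    by move=> s sm /=; lia.
  rewrite /strand_mult /=.
  case: w => [|[|[|w]]] /=; lia.
rewrite (@sum_interval_eq _ 0 w.+1 m (m - w.+1)); last lia; last first.
  by move=> s sm /=; lia.
rewrite (@sum_interval_eq _ 1 (maxn 1 w) m (m - maxn 1 w)); last lia; last first.
  by move=> s sm /=; lia.
rewrite (@sum_interval_eq _ 0 w.+3 m (m - w.+3)); last lia; last first.
  by move=> s sm /=; lia.
rewrite (@sum_interval_eq _ 1 w.+2 m (m - w.+2)); last lia; last first.
  by move=> s sm /=; lia.
rewrite /strand_mult /=.
case: w => [|[|w]] /=; lia.
Qed.

End Multiplicities.

(** * Flags and patterns *)

Section FlagPattern.
Variables (K : fieldType) (n : nat).

Lemma mem_span_delta (P : pred 'I_n) (v : 'cV[K]_n) :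
  v \in (\sum_(l < n | P l) <[delta_mx l ord0]>)%VS <->
  forall l, ~~ P l -> v l ord0 = 0.
Proof.
split=> [/memv_sumP[w ws ->] l nPl | v0].
  rewrite summxE big1 // => i Pi; have /vlineP[c ->] := ws i Pi.
  rewrite !mxE; case: eqP => [li|]; last by rewrite mulr0.
  by rewrite li Pi in nPl.
have -> : v = \sum_(l < n | P l) v l ord0 *: delta_mx l ord0.
  apply/colP => i; rewrite summxE; have [Pi|nPi] := boolP (P i).
    rewrite (bigD1 i) //= !mxE !eqxx mulr1 big1 ?addr0 // => l /andP[_ /negPf li].
    by rewrite !mxE eq_sym li mulr0.
  rewrite v0 // big1 // => l Pl; rewrite !mxE; case: eqP => [il|]; last by rewrite mulr0.
  by rewrite il Pl in nPi.
by apply: memv_sumr => l _; rewrite memvZ // memv_line.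
Qed.

Lemma stable_span_delta (P : pred 'I_n) (x : 'M[K]_n) :
  (forall v : 'cV[K]_n, v \in (\sum_(l < n | P l) <[delta_mx l ord0]>)%VS ->
     x *m v \in (\sum_(l < n | P l) <[delta_mx l ord0]>)%VS) <->
  forall i j, P j -> ~~ P i -> x i j = 0.
Proof.
split=> [xP i j Pj nPi | xP v /mem_span_delta v0].
  have dj : delta_mx j ord0 \in (\sum_(l < n | P l) <[delta_mx l ord0 : 'cV[K]_n]>)%VS.
    apply/mem_span_delta => l nPl.
    by rewrite mxE; case: eqP => // lj; rewrite lj Pj in nPl.
  have /mem_span_delta xj := xP _ dj.
  by have := xj i nPi; rewrite -colE mxE.
apply/mem_span_delta => i nPi; rewrite mxE big1 // => j _.
by have [Pj|/v0->] := boolP (P j); rewrite ?mulr0 // (xP i j) ?mul0r.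
Qed.

(** The second condition is the contrapositive of stability of the decreasing flag, so that both
    speak of initial segments. *)
Definition flag_pattern (a b : seq nat) (i j : nat) : bool :=
  all (fun t => (j < sumn (take t a)) ==> (i < sumn (take t a)))%N (iota 0 (size a).+1)
  && all (fun t => (i < sumn (take t b)) ==> (j < sumn (take t b)))%N (iota 0 (size b).+1).

Lemma mem_seaweed_pattern a b (x : 'M[K]_n) :
  x \in seaweed K n a b <->
  \tr x = 0 /\ forall i j : 'I_n, ~~ flag_pattern a b i j -> x i j = 0.
Proof.
split=> [/mem_seaweed[trx xa xb]|[trx xS]].
  split=> // i j; rewrite negb_and => /orP[] /allPn[t];
    rewrite mem_iota add0n ltnS negb_imply => /andP[_ tN] /andP[h1 h2].
    by have /stable_span_delta xat := xa t tN; apply: xat.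
  have /stable_span_delta xbt := xb t tN; apply: xbt; rewrite -?ltnNge //.
  by rewrite leqNgt.
apply/mem_seaweed; split=> // t tN; apply/stable_span_delta => i j Pj nPi; apply: xS;
  rewrite negb_and; apply/orP; [left|right]; apply/allPn; exists t;
  rewrite ?mem_iota ?add0n ?ltnS // negb_imply.
  by rewrite Pj.
by rewrite ltnNge nPi -leqNgt Pj.
Qed.

End FlagPattern.

Section FourBlocks.
Local Open Scope nat_scope.

Lemma flag_four_blocks k q e n i j :
    i < n -> j < n -> n = k + 4 * q + sumn e -> size e <= 1 -> sumn e <= 4 ->
  all (fun t => (j < sumn (take t (k :: nseq q 4 ++ e)))
                  ==> (i < sumn (take t (k :: nseq q 4 ++ e))))
      (iota 0 (size (k :: nseq q 4 ++ e)).+1)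
  = [|| i <= j, (i < k) && (j < k)
      | [&& k <= i, k <= j & (i - k) %/ 4 == (j - k) %/ 4]].
Proof.
move=> ni nj En e1 e4; set c := k :: _.
have sz : size c = (q + size e).+1 by rewrite /= size_cat size_nseq.
have sumc t : t <= q -> sumn (take t.+1 c) = k + 4 * t.
  move=> tq /=; rewrite take_cat size_nseq; case: ltnP => tq'.
    by rewrite take_nseq ?sumn_nseq //; lia.
  have -> : t = q by lia.
  by rewrite subnn take0 cats0 sumn_nseq.
have sumc' t : q.+1 < t <= size c -> sumn (take t c) = n.
  move=> tq; rewrite take_oversize; last by rewrite sz in tq *; lia.
  by rewrite /= sumn_cat sumn_nseq En; lia.
apply/allP/idP => [allc|same t].
  case: (leqP i j) => //= ji.
  case: (ltnP j k) => jk.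
    have := allc 1; rewrite mem_iota sz sumc // => /(_ _); rewrite muln0 addn0 jk /=.
    by rewrite andbT => ->.
  (* The flag step ending with the block of j must contain i; beyond the last of the q blocks, j < i
     puts both in the final one. *)
  have [sq|qs] := ltnP ((j - k) %/ 4) q.
    have := allc ((j - k) %/ 4).+2; rewrite mem_iota sz sumc //.
    by move=> /(_ ltac:(lia)); lia.
  lia.
rewrite mem_iota add0n ltnS => tN; apply/implyP.
case: t tN => [|t] tN; first by rewrite take0.
have [tq|qt] := leqP t q; first by rewrite sumc //; move: same; lia.
by rewrite sumc' //; lia.
Qed.

Lemma flag_pattern_seaweed m k q e p f n i j :
    0 < m -> k = 2 * m - 1 -> i < n -> j < n ->
    n = k + 4 * q + sumn e -> size e <= 1 -> sumn e <= 4 ->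
    n = k.+2 + 4 * p + sumn f -> size f <= 1 -> sumn f <= 4 ->
  flag_pattern (k :: nseq q 4 ++ e) (k.+2 :: nseq p 4 ++ f) i j = seaweed_pattern m i j.
Proof.
move=> m_gt0 Ek ni nj Ea a1 a4 Eb b1 b4; rewrite /flag_pattern.
rewrite (flag_four_blocks ni nj Ea) // (flag_four_blocks nj ni Eb) //.
rewrite /seaweed_pattern -Ek; congr (_ && _); first by rewrite orbA.
by rewrite -orbA [(i < _) && _]andbC [(_ %/ 4 == _)]eq_sym andbCA.
Qed.

End FourBlocks.

Lemma count_strand_diff m u (i0 : 'I_(2 * m - 1 + 2 * u)) z : (0 < m)%N -> (1 < u)%N ->
  count_mem z [seq strand_diff p | p in
     pattern_pairs (fun i j : 'I_(2 * m - 1 + 2 * u) => seaweed_pattern m i j) i0]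
  = strand_mult m u (if (0 < z)%R then `|z - 1|%N else `|z|%N).
Proof.
move=> m_gt0 u_gt1; rewrite -sum1_count big_image_cond /=.
have := total_strand_count m_gt0 u_gt1 z; rewrite pair_big /= => E.
pose P (p : 'I_(2 * m - 1 + 2 * u) * 'I_(2 * m - 1 + 2 * u)) :=
  seaweed_pattern m p.1 p.2 && (strand_diff p == z).
have {}E : (\sum_(p | P p) 1 = strand_mult m u (if (0 < z)%R then `|z - 1|%N else `|z|%N) + (z == 0))%N.
  rewrite -E big_mkcond; apply: eq_bigr => p _.
  by rewrite /P seaweed_patternE // /strand_count; case: ifP.
have P0 : P (i0, i0) = (z == 0).
  by rewrite /P seaweed_patternE //= /strand_pattern eqxx /strand_diff subrr eq_sym.
(* The pair (i0, i0), of difference 0, is put back to compare with the count over the full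
   pattern. *)
apply/eqP; rewrite -(eqn_add2r (z == 0)) -E; apply/eqP.
rewrite [RHS](bigID (pred1 (i0, i0))) /= addnC; congr (_ + _)%N.
  rewrite (eq_bigl (fun p => (p == (i0, i0)) && (z == 0))); last first.
    by move=> p; case: eqP => [->|]; rewrite ?andbF // P0 andbT.
  by case: (z == 0); rewrite ?andbF; [rewrite (big_pred1 (i0, i0)) // => p; rewrite andbT | rewrite big_pred0 // => p; rewrite andbF].
apply: eq_bigl => p; rewrite inE /P.
by rewrite andbAC.
Qed.

(** * Spectrum and unimodality of any seaweed with this pattern *)

Section SeaweedSpectrum.
Variables (K : numFieldType) (m u n : nat) (a b : seq nat).
Hypotheses (m_gt0 : (0 < m)%N) (u_gt1 : (1 < u)%N) (En : n = (2 * m - 1 + 2 * u)%N).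
Hypothesis abP : forall i j : 'I_n, flag_pattern a b i j = seaweed_pattern m i j.

Definition eigenvalue_mult (z : int) : nat :=
  strand_mult m u (if 0 < z then `|z - 1|%N else `|z|%N).

Lemma has_spectrum_seaweed (s : seq int) :
    (forall z, count_mem z s = eigenvalue_mult z) ->
  has_spectrum (seaweed K n a b) [seq z%:~R | z <- s].
Proof.
move=> sE; move: abP; rewrite En => abP'.
have i0 : 'I_(2 * m - 1 + 2 * u) by apply: (@Ordinal _ 0); lia.
apply: (@has_spectrum_strand K m u m_gt0 u_gt1 _ _ _ i0).
- by move=> x y; apply: seaweed_mxbr.
- move=> x; rewrite mem_seaweed_pattern.
  by split=> -[trx xS]; split=> // i j; have := xS i j; rewrite abP'.
apply/allP => z _ /=; rewrite sE.
by rewrite (count_strand_diff i0 z m_gt0 u_gt1).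
Qed.

Lemma eigenvalue_mult_gt0 z : (0 < eigenvalue_mult z)%N = (- m%:Z <= z <= m%:Z + 1).
Proof. by rewrite /eigenvalue_mult /strand_mult; case: ifP => z0; lia. Qed.

Lemma eigenvalue_mult_up (i : nat) : (i < m)%N ->
  (eigenvalue_mult (i%:Z - m%:Z) <= eigenvalue_mult (i.+1%:Z - m%:Z))%N.
Proof.
move=> im; rewrite /eigenvalue_mult.
have -> : 0 < i%:Z - m%:Z = false by lia.
have -> : 0 < i.+1%:Z - m%:Z = false by lia.
have -> : `|i%:Z - m%:Z|%N = (m - i)%N by lia.
have -> : `|i.+1%:Z - m%:Z|%N = (m - i).-1 by lia.
have : (0 < m - i <= m)%N by lia.
by case: (m - i)%N => // -[|[|w]] wm; rewrite /strand_mult /=; lia.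
Qed.

Lemma eigenvalue_mult_down (i : nat) : (m <= i)%N ->
  (eigenvalue_mult (i.+1%:Z - m%:Z) <= eigenvalue_mult (i%:Z - m%:Z))%N.
Proof.
move=> mi; rewrite /eigenvalue_mult.
have -> : 0 < i.+1%:Z - m%:Z by lia.
have -> : absz (i.+1%:Z - m%:Z - 1)%R = (i - m)%N by lia.
have -> : (if 0 < i%:Z - m%:Z then absz (i%:Z - m%:Z - 1)%R else `|i%:Z - m%:Z|%N)
   = (i - m).-1 by case: ifP; lia.
by case: (i - m)%N => [|[|[|w]]] //; rewrite /strand_mult /=; lia.
Qed.

Lemma unimodal_spectrum_seaweed (s : seq int) :
    (forall z, count_mem z s = eigenvalue_mult z) ->
  unimodal_spectrum (seaweed K n a b).
Proof.
move=> sE; exists [seq z%:~R | z <- s]; first exact: has_spectrum_seaweed.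
pose v (i : nat) : int := i%:Z - m%:Z.
exists [seq (v i)%:~R | i <- iota 0 (2 * m + 2)]; split.
- rewrite sorted_map; apply: (sub_sorted _ (iota_ltn_sorted _ _)).
  by move=> i j /= ij; rewrite ltr_int /v; lia.
- move=> x; apply/mapP/mapP => -[].
    move=> i; rewrite mem_iota => iN ->; exists (v i) => //.
    by rewrite -has_pred1 has_count sE eigenvalue_mult_gt0 /v; lia.
  move=> z; rewrite -has_pred1 has_count sE eigenvalue_mult_gt0 => zm ->.
  exists (absz (z + m%:Z)); first by rewrite mem_iota; lia.
  by congr (_ %:~R); rewrite /v; lia.
have -> : [seq count_mem x [seq z%:~R | z <- s] | x <- [seq (v i)%:~R : K | i <- iota 0 (2 * m + 2)]]
    = [seq eigenvalue_mult (v i) | i <- iota 0 (2 * m + 2)].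
  rewrite -map_comp; apply: eq_map => i /=; rewrite -sE count_map.
  by apply: eq_count => z /=; rewrite eqr_int.
(* Index m is the eigenvalue 0; the eigenvalue 1 has the same multiplicity, so the descent may start
   here. *)
exists m; first by rewrite size_map size_iota; lia.
rewrite -map_take -map_drop take_iota drop_iota; split.
  have -> : minn m.+1 (2 * m + 2) = m.+1 by lia.
  apply/(sortedP 0%N) => i; rewrite size_map size_iota => im.
  by rewrite !(nth_map 0%N) ?size_iota // ?nth_iota //; [apply: eigenvalue_mult_up|..]; lia.
apply/(sortedP 0%N) => i; rewrite size_map size_iota => im.
rewrite !(nth_map 0%N) ?size_iota ?nth_iota //; try lia.
by rewrite addnS /=; apply: eigenvalue_mult_down; lia.
Qed.

End SeaweedSpectrum.

(** * Comparison with the explicit lists of eigenvalues *)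

Lemma count_spectrum1 (u : nat) z : (1 < u)%N ->
  count_mem z (nseq u (-1) ++ nseq (3 * u - 1) 0 ++ nseq (3 * u - 1) 1 ++ nseq u 2)
  = eigenvalue_mult 1 u z.
Proof.
move=> u_gt1; rewrite /eigenvalue_mult /strand_mult !count_cat !count_nseq /=.
case: z => [[|[|[|w]]]|[|w]] /=; lia.
Qed.

Lemma count_spectrum3 (u : nat) z : (1 < u)%N ->
  count_mem z ([:: -2] ++ nseq (u + 2) (-1) ++ nseq (3 * u + 2) 0 ++ nseq (3 * u + 2) 1
               ++ nseq (u + 2) 2 ++ [:: 3])
  = eigenvalue_mult 2 u z.
Proof.
move=> u_gt1; rewrite /eigenvalue_mult /strand_mult !count_cat !count_nseq /=.
case: z => [[|[|[|[|w]]]]|[|[|w]]] /=; lia.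
Qed.

(** The index i is m - w for 2 <= w <= m - 2, the range where [strand_mult] is 4 (m - w) - 2; it is
    empty for m = 3. *)
Definition spectrum_wings (m : nat) : seq int :=
  \big[cat/[::]]_(2 <= i < (m - 2).+1)
    (nseq (4 * i - 2) (- m%:Z + i%:Z) ++ nseq (4 * i - 2) (m%:Z - i%:Z + 1)).

Lemma count_spectrum_wings m z : (2 < m)%N ->
  count_mem z (spectrum_wings m) =
  ((- m%:Z + 2 <= z <= -2)%R * (4 * absz (z + m%:Z)%R - 2)
   + (3 <= z <= m%:Z - 1)%R * (4 * absz (m%:Z - z + 1)%R - 2))%N.
Proof.
move=> m_gt2; rewrite /spectrum_wings (big_morph _ (count_cat _) (erefl : count_mem z [::] = 0%N)).
under eq_bigr do rewrite count_cat !count_nseq.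
rewrite big_split /=; congr (_ + _)%N.
  have [zr|nz] := boolP (- m%:Z + 2 <= z <= -2)%R; last first.
    by rewrite mul0n big_nat big1 // => i im; case: eqP => //; lia.
  rewrite (eq_big_nat _ _ (F2 := fun i => if i == absz (z + m%:Z)%R then 4 * i - 2 else 0)%N) => [|i im].
    rewrite -big_mkcond big_nat1_eq; case: ifP; lia.
  by case: eqP; case: eqP; lia.
have [zr|nz] := boolP (3 <= z <= m%:Z - 1)%R; last first.
  by rewrite mul0n big_nat big1 // => i im; case: eqP => //; lia.
rewrite (eq_big_nat _ _ (F2 := fun i => if i == absz (m%:Z - z + 1)%R then 4 * i - 2 else 0)%N) => [|i im].
  rewrite -big_mkcond big_nat1_eq; case: ifP; lia.
by case: eqP; case: eqP; lia.
Qed.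

Lemma count_spectrum5 (m u : nat) z : (2 < m)%N -> (1 < u)%N ->
  count_mem z ([:: - m%:Z] ++ nseq 3 (- m%:Z + 1) ++ nseq (4 * m + u - 7) (-1)
    ++ nseq (4 * m + 3 * u - 6) 0 ++ nseq (4 * m + 3 * u - 6) 1
    ++ nseq (4 * m + u - 7) 2 ++ nseq 3 m%:Z ++ [:: m%:Z + 1] ++ spectrum_wings m)
  = eigenvalue_mult m u z.
Proof.
move=> m_gt2 u_gt1; rewrite !count_cat count_spectrum_wings // !count_nseq /=.
case: z => [[|[|[|w]]]|[|w]].
- have -> : (- m%:Z == 0%:Z) = false by lia.
  have -> : (- m%:Z + 1 == 0%:Z) = false by lia.
  have -> : (m%:Z == 0%:Z) = false by lia.
  have -> : (m%:Z + 1 == 0%:Z) = false by lia.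
  have -> : (- m%:Z + 2 <= 0%:Z <= -2) = false by lia.
  have -> : (3 <= 0%:Z <= m%:Z - 1) = false by lia.
  rewrite /eigenvalue_mult /strand_mult /=; lia.
- have -> : (- m%:Z == 1%:Z) = false by lia.
  have -> : (- m%:Z + 1 == 1%:Z) = false by lia.
  have -> : (m%:Z == 1%:Z) = false by lia.
  have -> : (m%:Z + 1 == 1%:Z) = false by lia.
  have -> : (- m%:Z + 2 <= 1%:Z <= -2) = false by lia.
  have -> : (3 <= 1%:Z <= m%:Z - 1) = false by lia.
  rewrite /eigenvalue_mult /strand_mult /=; lia.
- have -> : (- m%:Z == 2%:Z) = false by lia.
  have -> : (- m%:Z + 1 == 2%:Z) = false by lia.
  have -> : (m%:Z == 2%:Z) = false by lia.
  have -> : (m%:Z + 1 == 2%:Z) = false by lia.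
  have -> : (- m%:Z + 2 <= 2%:Z <= -2) = false by lia.
  have -> : (3 <= 2%:Z <= m%:Z - 1) = false by lia.
  rewrite /eigenvalue_mult /strand_mult /=; lia.
(* The eigenvalue w + 3 is on the wing, equal to m, equal to m + 1, or beyond. *)
- have [wm|wm] := leqP w.+4 m.
  have -> : (- m%:Z == w.+3%:Z) = false by lia.
  have -> : (- m%:Z + 1 == w.+3%:Z) = false by lia.
  have -> : (m%:Z == w.+3%:Z) = false by lia.
  have -> : (m%:Z + 1 == w.+3%:Z) = false by lia.
  have -> : (- m%:Z + 2 <= w.+3%:Z <= -2) = false by lia.
  have -> : (3 <= w.+3%:Z <= m%:Z - 1) = true by lia.
  have -> : absz (m%:Z - w.+3%:Z + 1) = (m - w.+2)%N by lia.
  rewrite /eigenvalue_mult /strand_mult /=; lia.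
  have [{}wm|w3] := eqVneq m w.+3.
  have -> : (- m%:Z == w.+3%:Z) = false by lia.
  have -> : (- m%:Z + 1 == w.+3%:Z) = false by lia.
  have -> : (m%:Z == w.+3%:Z) = true by lia.
  have -> : (m%:Z + 1 == w.+3%:Z) = false by lia.
  have -> : (- m%:Z + 2 <= w.+3%:Z <= -2) = false by lia.
  have -> : (3 <= w.+3%:Z <= m%:Z - 1) = false by lia.
  rewrite /eigenvalue_mult /strand_mult /=; lia.
  have [{}w3|w2] := eqVneq m w.+2.
  have -> : (- m%:Z == w.+3%:Z) = false by lia.
  have -> : (- m%:Z + 1 == w.+3%:Z) = false by lia.
  have -> : (m%:Z == w.+3%:Z) = false by lia.
  have -> : (m%:Z + 1 == w.+3%:Z) = true by lia.
  have -> : (- m%:Z + 2 <= w.+3%:Z <= -2) = false by lia.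
  have -> : (3 <= w.+3%:Z <= m%:Z - 1) = false by lia.
  rewrite /eigenvalue_mult /strand_mult /=; lia.
  have -> : (- m%:Z == w.+3%:Z) = false by lia.
  have -> : (- m%:Z + 1 == w.+3%:Z) = false by lia.
  have -> : (m%:Z == w.+3%:Z) = false by lia.
  have -> : (m%:Z + 1 == w.+3%:Z) = false by lia.
  have -> : (- m%:Z + 2 <= w.+3%:Z <= -2) = false by lia.
  have -> : (3 <= w.+3%:Z <= m%:Z - 1) = false by lia.
  rewrite /eigenvalue_mult /strand_mult /=; lia.
- have -> : (- m%:Z == Negz 0) = false by lia.
  have -> : (- m%:Z + 1 == Negz 0) = false by lia.
  have -> : (m%:Z == Negz 0) = false by lia.
  have -> : (m%:Z + 1 == Negz 0) = false by lia.
  have -> : (- m%:Z + 2 <= Negz 0 <= -2) = false by lia.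
  have -> : (3 <= Negz 0 <= m%:Z - 1) = false by lia.
  rewrite /eigenvalue_mult /strand_mult /=; lia.
have [wm|wm] := leqP w.+4 m.
  have -> : (- m%:Z == Negz w.+1) = false by lia.
  have -> : (- m%:Z + 1 == Negz w.+1) = false by lia.
  have -> : (m%:Z == Negz w.+1) = false by lia.
  have -> : (m%:Z + 1 == Negz w.+1) = false by lia.
  have -> : (- m%:Z + 2 <= Negz w.+1 <= -2) = true by lia.
  have -> : (3 <= Negz w.+1 <= m%:Z - 1) = false by lia.
  have -> : absz (Negz w.+1 + m%:Z) = (m - w.+2)%N by lia.
  rewrite /eigenvalue_mult /strand_mult /=; lia.
have [{}wm|w3] := eqVneq m w.+3.
  have -> : (- m%:Z == Negz w.+1) = false by lia.
  have -> : (- m%:Z + 1 == Negz w.+1) = true by lia.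
  have -> : (m%:Z == Negz w.+1) = false by lia.
  have -> : (m%:Z + 1 == Negz w.+1) = false by lia.
  have -> : (- m%:Z + 2 <= Negz w.+1 <= -2) = false by lia.
  have -> : (3 <= Negz w.+1 <= m%:Z - 1) = false by lia.
  rewrite /eigenvalue_mult /strand_mult /=; lia.
have [{}w3|w2] := eqVneq m w.+2.
  have -> : (- m%:Z == Negz w.+1) = true by lia.
  have -> : (- m%:Z + 1 == Negz w.+1) = false by lia.
  have -> : (m%:Z == Negz w.+1) = false by lia.
  have -> : (m%:Z + 1 == Negz w.+1) = false by lia.
  have -> : (- m%:Z + 2 <= Negz w.+1 <= -2) = false by lia.
  have -> : (3 <= Negz w.+1 <= m%:Z - 1) = false by lia.
  rewrite /eigenvalue_mult /strand_mult /=; lia.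
  have -> : (- m%:Z == Negz w.+1) = false by lia.
  have -> : (- m%:Z + 1 == Negz w.+1) = false by lia.
  have -> : (m%:Z == Negz w.+1) = false by lia.
  have -> : (m%:Z + 1 == Negz w.+1) = false by lia.
  have -> : (- m%:Z + 2 <= Negz w.+1 <= -2) = false by lia.
  have -> : (3 <= Negz w.+1 <= m%:Z - 1) = false by lia.
  rewrite /eigenvalue_mult /strand_mult /=; lia.
Qed.

Section FourBlockSpectra.
Variables (K : numFieldType) (m u n : nat) (a b : seq nat).
Hypotheses (m_gt0 : (0 < m)%N) (u_gt1 : (1 < u)%N) (En : n = (2 * m - 1 + 2 * u)%N).
Hypothesis abP : forall i j : 'I_n, flag_pattern a b i j = seaweed_pattern m i j.
Local Notation g := (seaweed K n a b).

Lemma unimodal_spectrum_four_blocks : unimodal_spectrum g.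
Proof.
have [m1|m_gt1] := leqP m 1.
  have sE z := count_spectrum1 z u_gt1.
  apply: (unimodal_spectrum_seaweed K m_gt0 u_gt1 En abP) => z.
  by have -> : m = 1%N; [lia | exact: sE].
have [m2|m_gt2] := leqP m 2.
  have sE z := count_spectrum3 z u_gt1.
  apply: (unimodal_spectrum_seaweed K m_gt0 u_gt1 En abP) => z.
  by have -> : m = 2%N; [lia | exact: sE].
exact: (unimodal_spectrum_seaweed K m_gt0 u_gt1 En abP
  (fun z => count_spectrum5 z m_gt2 u_gt1)).
Qed.

Lemma has_spectrum_four_blocks1 A B : m = 1%N -> A = u -> B = (3 * u - 1)%N ->
  has_spectrum g (nseq A (-1) ++ nseq B 0 ++ nseq B 1 ++ nseq A 2%:R).
Proof.
move=> Em -> ->.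
have := has_spectrum_seaweed K m_gt0 u_gt1 En abP (s := nseq u (-1) ++
  nseq (3 * u - 1) 0 ++ nseq (3 * u - 1) 1 ++ nseq u 2).
rewrite !map_cat !map_nseq; apply=> z.
by rewrite Em count_spectrum1.
Qed.

Lemma has_spectrum_four_blocks3 A B : m = 2%N -> A = (u + 2)%N -> B = (3 * u + 2)%N ->
  has_spectrum g ([:: - 2%:R] ++ nseq A (-1) ++ nseq B 0 ++ nseq B 1
                  ++ nseq A 2%:R ++ [:: 3%:R]).
Proof.
move=> Em -> ->.
have := has_spectrum_seaweed K m_gt0 u_gt1 En abP (s := [:: -2] ++ nseq (u + 2) (-1) ++
  nseq (3 * u + 2) 0 ++ nseq (3 * u + 2) 1 ++ nseq (u + 2) 2 ++ [:: 3]).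
rewrite !map_cat !map_nseq; apply=> z.
by rewrite Em count_spectrum3.
Qed.

Lemma has_spectrum_four_blocks5 A B : (2 < m)%N ->
    A = (4 * m + u - 7)%N -> B = (4 * m + 3 * u - 6)%N ->
  has_spectrum g ([:: - m%:R] ++ nseq 3 (- m%:R + 1) ++ nseq A (-1) ++ nseq B 0
    ++ nseq B 1 ++ nseq A 2%:R ++ nseq 3 m%:R ++ [:: m%:R + 1] ++
    \big[cat/[::]]_(2 <= i < (m - 2).+1)
      (nseq (4 * i - 2) (- m%:R + i%:R) ++ nseq (4 * i - 2) (m%:R - i%:R + 1))).
Proof.
move=> m_gt2 -> ->.
have := has_spectrum_seaweed K m_gt0 u_gt1 En abP
  (fun z => count_spectrum5 z m_gt2 u_gt1).
rewrite !map_cat !map_nseq /= !intrD !mulrNz.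
rewrite /spectrum_wings (big_morph _ (map_cat _) (erefl : map _ [::] = [::])).
under eq_bigr do rewrite map_cat !map_nseq !intrD !mulrNz.
by [].
Qed.

End FourBlockSpectra.

Unset Implicit Arguments.

Theorem mainTheorem9 (R : realType) (m k r : nat)
    (hk : k = (2 * m - 1)%N) (hk1 : (1 <= k)%N) (hr : (1 <= r)%N) :
  (let g : {vspace 'M[R[i]]_(k + 4 * r)} :=
     seaweed R[i] (k + 4 * r) (k :: nseq r 4%N)
                              ((k + 2)%N :: rcons (nseq (r - 1) 4%N) 2%N) in
   [/\ unimodal_spectrum g,
       k = 1%N ->
         has_spectrum g
           (nseq (2 * r) (-1) ++ nseq (6 * r - 1) 0 ++
            nseq (6 * r - 1) 1 ++ nseq (2 * r) 2%:R),
       k = 3%N ->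
         has_spectrum g
           ([:: - 2%:R] ++ nseq (2 * r + 2) (-1) ++ nseq (6 * r + 2) 0 ++
            nseq (6 * r + 2) 1 ++ nseq (2 * r + 2) 2%:R ++ [:: 3%:R])
     & (3 < k)%N ->
         has_spectrum g
           ([:: - m%:R] ++ nseq 3 (- m%:R + 1) ++
            nseq (2 * (k + r) - 5) (-1) ++ nseq (2 * (k + 3 * r) - 4) 0 ++
            nseq (2 * (k + 3 * r) - 4) 1 ++ nseq (2 * (k + r) - 5) 2%:R ++
            nseq 3 m%:R ++ [:: m%:R + 1] ++
            \big[cat/[::]]_(2 <= i < (m - 2).+1)
              (nseq (4 * i - 2) (- m%:R + i%:R) ++
               nseq (4 * i - 2) (m%:R - i%:R + 1)))])
  /\
  (let g : {vspace 'M[R[i]]_(k + 4 * r + 2)} :=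
     seaweed R[i] (k + 4 * r + 2) (k :: rcons (nseq r 4%N) 2%N)
                                  ((k + 2)%N :: nseq r 4%N) in
   [/\ unimodal_spectrum g,
       k = 1%N ->
         has_spectrum g
           (nseq (2 * r + 1) (-1) ++ nseq (6 * r + 2) 0 ++
            nseq (6 * r + 2) 1 ++ nseq (2 * r + 1) 2%:R),
       k = 3%N ->
         has_spectrum g
           ([:: - 2%:R] ++ nseq (2 * r + 3) (-1) ++ nseq (6 * r + 5) 0 ++
            nseq (6 * r + 5) 1 ++ nseq (2 * r + 3) 2%:R ++ [:: 3%:R])
     & (3 < k)%N ->
         has_spectrum g
           ([:: - m%:R] ++ nseq 3 (- m%:R + 1) ++
            nseq (2 * (k + r) - 4) (-1) ++ nseq (2 * (k + 3 * r) - 1) 0 ++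
            nseq (2 * (k + 3 * r) - 1) 1 ++ nseq (2 * (k + r) - 4) 2%:R ++
            nseq 3 m%:R ++ [:: m%:R + 1] ++
            \big[cat/[::]]_(2 <= i < (m - 2).+1)
              (nseq (4 * i - 2) (- m%:R + i%:R) ++
               nseq (4 * i - 2) (m%:R - i%:R + 1)))]).
Proof.
have m_gt0 : (0 < m)%N by lia.
rewrite addn2; split.
  set a := k :: _; set b := _ :: _.
  have u_gt1 : (1 < 2 * r)%N by lia.
  have En : (k + 4 * r = 2 * m - 1 + 2 * (2 * r))%N by lia.
  have abP (i j : 'I_(k + 4 * r)) : flag_pattern a b i j = seaweed_pattern m i j.
    rewrite /a /b -cats1 -[nseq r 4%N]cats0.
    by apply: (@flag_pattern_seaweed _ _ _ _ _ _ (k + 4 * r)) => //=; lia.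
  split=> [|k1|k3|k5].
  - exact: (unimodal_spectrum_four_blocks R[i] m_gt0 u_gt1 En abP).
  - by apply: (has_spectrum_four_blocks1 R[i] m_gt0 u_gt1 En abP); lia.
  - by apply: (has_spectrum_four_blocks3 R[i] m_gt0 u_gt1 En abP); lia.
  by apply: (has_spectrum_four_blocks5 R[i] m_gt0 u_gt1 En abP); lia.
set a := k :: _; set b := _ :: _.
have u_gt1 : (1 < 2 * r + 1)%N by lia.
have En : (k + 4 * r + 2 = 2 * m - 1 + 2 * (2 * r + 1))%N by lia.
have abP (i j : 'I_(k + 4 * r + 2)) : flag_pattern a b i j = seaweed_pattern m i j.
  rewrite /a /b -cats1 -[nseq r 4%N in X in flag_pattern _ X]cats0.
  by apply: (@flag_pattern_seaweed _ _ _ _ _ _ (k + 4 * r + 2)) => //=; lia.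
split=> [|k1|k3|k5].
- exact: (unimodal_spectrum_four_blocks R[i] m_gt0 u_gt1 En abP).
- by apply: (has_spectrum_four_blocks1 R[i] m_gt0 u_gt1 En abP); lia.
- by apply: (has_spectrum_four_blocks3 R[i] m_gt0 u_gt1 En abP); lia.
by apply: (has_spectrum_four_blocks5 R[i] m_gt0 u_gt1 En abP); lia.
Qed.
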